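(* Let $R_n$ be the $n$th correlation function of the complex Ginibre ensemble of $N\times N$ matrices. Let $u$ be in the closed unit disk, let $s_1,\dots,s_n\in\mathbb C$, and set $z_k=u\sqrt N+s_k$, $k=1,\dots,n$. Then: (1) (Bulk) If $|u|<1$, $$\lim_{N\to\infty}R_n(\mathbf z)=\det\left[\frac1{2\pi}\exp\left(-\frac{|s_k|^2}2-\frac{|s_{k'}|^2}2+s_k\overline s_{k'}\right)\right]_{k,k'=1}^n.$$ (2) (Edge) If $|u|=1$, $$\lim_{N\to\infty}R_n(\mathbf z)=\det\left[\frac1{2\pi}\exp\left(-\frac{|s_k|^2}2-\frac{|s_{k'}|^2}2+s_k\overline s_{k'}\right)\operatorname{erfc}\left(\frac{s_k\overline u+\overline s_{k'}u}{\sqrt2}\right)\right]_{k,k'=1}^n.$$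
   Context: The complex Ginibre ensemble consists of $N\times N$ complex matrices with i.i.d. normal entries. Its eigenvalues have joint density proportional to $\Omega_N(\boldsymbol\gamma)=\prod_{j=1}^Ne^{-|\gamma_j|^2}\,|\Delta(\boldsymbol\gamma)|^2$, $\boldsymbol\gamma\in\mathbb C^N$, where $\Delta$ is the Vandermonde determinant in $\gamma_1,\dots,\gamma_N$. With $Z=\frac1{N!}\int_{\mathbb C^N}\Omega_N(\boldsymbol\gamma)\,d\boldsymbol\gamma$ (Lebesgue measure), the $n$th correlation function is, for $\mathbf z\in\mathbb C^n$, $$R_n(\mathbf z)=\frac1Z\cdot\frac1{(N-n)!}\int_{\mathbb C^{N-n}}\Omega_N(z_1,\dots,z_n,\gamma_1,\dots,\gamma_{N-n})\,d\gamma_1\cdots d\gamma_{N-n}.$$ $\operatorname{erfc}$ is extended to an entire function.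
   Formalization: In part (1) the bulk constant 1/(2π) is corrected to 1/π: as printed the claim is false, e.g. for n=1, u=0, s=0 one has R_1(0)=1/π for every N≥1. Part (2) is as printed. *)

(* Defs.v *)
From HB Require Import structures.
From mathcomp Require Import all_boot all_order all_algebra.
From mathcomp Require Import complex ring.
From mathcomp Require Import all_classical all_reals all_analysis.
From mathcomp Require Import measurable_realfun.

Set Implicit Arguments.
Unset Strict Implicit.
Unset Printing Implicit Defensive.

Import Order.TTheory GRing.Theory Num.Theory.
Import numFieldNormedType.Exports.

Local Open Scope classical_set_scope.
Local Open Scope complex_scope.
Local Open Scope ring_scope.

(* The library proves this, but canonical inference on [m1 \x m2] only finds the
   instance meant for two subprobabilities. *)
Lemma product_measure_sigma_finite d1 d2 (T1 : measurableType d1)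
    (T2 : measurableType d2) (R : realType)
    (m1 : {sigma_finite_measure set T1 -> \bar R})
    (m2 : {sigma_finite_measure set T2 -> \bar R}) :
  sigma_finite setT (m1 \x m2)%E.
Proof.
have /sigma_finiteP[F [TF ndF Foo]] := sigma_finiteT m1.
have /sigma_finiteP[G [TG ndG Goo]] := sigma_finiteT m2.
exists (fun n => F n `*` G n).
  rewrite -setXTT TF TG predeqE => -[x y]; split.
    move=> [/= [n _ Fnx] [k _ Gky]]; exists (maxn n k) => //; split.
    - by move: x Fnx; exact/subsetPset/ndF/leq_maxl.
    - by move: y Gky; exact/subsetPset/ndG/leq_maxr.
  by move=> [n _ []/= ? ?]; split; exists n.
move=> k; have [? ?] := Foo k; have [? ?] := Goo k.
split; first exact: measurableX.
by rewrite product_measure1E// lte_mul_pinfty// ge0_fin_numE.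
Qed.

Definition tuple_cons (T : Type) m (p : T * m.-tuple T) : m.+1.-tuple T :=
  [the m.+1.-tuple T of p.1 :: p.2].

Lemma measurable_tuple_cons d (T : measurableType d) m :
  measurable_fun setT (@tuple_cons T m).
Proof. exact: measurable_cons. Qed.

Section tuple_cons_measure.
Context d (T : measurableType d) (R : realType).
Variables (mu : {sigma_finite_measure set T -> \bar R}) (m : nat).
Variable nu : {sigma_finite_measure set (m.-tuple T) -> \bar R}.

Definition tuple_cons_measure : set (m.+1.-tuple T) -> \bar R :=
  pushforward (mu \x nu)%E (@tuple_cons T m).

HB.instance Definition _ := Measure.copy tuple_cons_measure
  (measure_function_pushforward__canonical__measure_function_Measure
     (mu \x nu)%E (@measurable_tuple_cons d T m)).

Let tuple_cons_measure_sigma_finite : sigma_finite setT tuple_cons_measure.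
Proof.
have [F TF Foo] := product_measure_sigma_finite mu nu.
pose uncons (t : m.+1.-tuple T) : T * m.-tuple T :=
  (thead t, [tuple of behead t]).
have unconsK : cancel uncons (@tuple_cons T m).
  by move=> t; apply/val_inj; rewrite [in RHS](tuple_eta t).
have consK : cancel (@tuple_cons T m) uncons.
  by move=> [x t]; rewrite /uncons theadE; congr pair; apply/val_inj.
have muncons : measurable_fun setT uncons.
  apply/measurable_fun_pairP; split => /=.
    exact: measurable_tnth.
  exact: measurable_behead.
exists (fun i => uncons @^-1` F i).
  by rewrite -preimage_bigcup -TF preimage_setT.
move=> i; have [mF Fi] := Foo i; split.
  by rewrite -[X in measurable X]setTI; exact: muncons.
rewrite /tuple_cons_measure /pushforward -comp_preimage.
by rewrite (_ : uncons \o _ = idfun)//; apply/funext => p; exact: consK.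
Qed.

HB.instance Definition _ := Measure_isSigmaFinite.Build _ _ _
  tuple_cons_measure tuple_cons_measure_sigma_finite.

End tuple_cons_measure.

(* mu^m on m-tuples, through T^(m+1) = T * T^m; the 0th power is the unit mass at
   the empty tuple. *)
Fixpoint power_measure d (T : measurableType d) (R : realType)
    (mu : {sigma_finite_measure set T -> \bar R}) m :
    {sigma_finite_measure set (m.-tuple T) -> \bar R} :=
  if m is m'.+1 then tuple_cons_measure mu (power_measure mu m')
  else \d_([tuple] : 0.-tuple T).

Lemma ge0_integral_power_measureS d (T : measurableType d) (R : realType)
    (mu : {sigma_finite_measure set T -> \bar R}) m
    (f : m.+1.-tuple T -> \bar R) :
  measurable_fun [set: m.+1.-tuple T] f -> (forall t, 0 <= f t)%E ->
  (\int[power_measure mu m.+1]_t f t =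
   \int[mu]_x \int[power_measure mu m]_t f (tuple_cons (x, t)))%E.
Proof.
move=> mf f0.
rewrite /= (@ge0_integral_pushforward _ _ _ _ _ _ (@measurable_tuple_cons _ T m)
  (mu \x power_measure mu m)%E setT f)//.
rewrite preimage_setT fubini_tonelli1//.
  by apply: measurableT_comp => //; exact: measurable_tuple_cons.
by move=> p; exact: f0.
Qed.

Section ginibre.
Variable R : realType.
Local Notation C := R[i].
Local Notation mu := (@lebesgue_measure R).
Local Notation plane := (measurableTypeR R * measurableTypeR R)%type.

(* The complex numbers carry no measure in the library: the integrals over C^m
   are taken over m-tuples of points (x, y) of R^2, read as x + iy. *)
Definition plane_lebesgue : set plane -> \bar R := (mu \x mu)%E.

HB.instance Definition _ := Measure.on plane_lebesgue.

HB.instance Definition _ := Measure_isSigmaFinite.Build _ _ _ plane_lebesgue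
  (product_measure_sigma_finite mu mu).

Definition complex_row m (g : m.-tuple plane) : 'rV[C]_m :=
  \row_(j < m) ((tnth g j).1 +i* (tnth g j).2).

Definition ginibre_weight N (g : 'rV[C]_N) : R :=
  \prod_(j < N) expR (- Normc.normc (g 0 j) ^+ 2) *
  Normc.normc (\det (Vandermonde N g)) ^+ 2.

Definition ginibre_partition N : R :=
  (N`!%:R)^-1 *
  \int[power_measure plane_lebesgue N]_(g in setT)
    ginibre_weight (complex_row g).

(* Since [N - n] is truncated, this is the correlation function only for
   [n <= N], where [n + (N - n) = N]. *)
Definition ginibre_correlation N n (z : 'rV[C]_n) : R :=
  (ginibre_partition N)^-1 * ((N - n)`!%:R)^-1 *
  \int[power_measure plane_lebesgue (N - n)]_(g in setT)
    ginibre_weight (row_mx z (complex_row g)).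

Definition cexp (z : C) : C :=
  (expR (complex.Re z))%:C * (cos (complex.Im z) +i* sin (complex.Im z)).

(* 1 - 2 / sqrt pi * (integral of exp(- w^2) dw along the segment from 0 to z),
   an entire function of z; [cerfcR] gives its values on the real line. *)
Definition cerfc (z : C) : C :=
  let f (t : R) := cexp (- (t%:C * z) ^+ 2) in
  1 - (2 / Num.sqrt pi)%:C * z *
      ((\int[mu]_(t in `[0, 1]) complex.Re (f t)) +i*
       (\int[mu]_(t in `[0, 1]) complex.Im (f t))).

Local Lemma gauss_integrable (D : set R) : measurable D ->
  mu.-integrable D (EFin \o @gauss_fun R).
Proof.
by move=> mD; apply: integrableS (@integrableT_gauss R).
Qed.

Local Lemma gauss_primitive (G := fun y : R =>
    \int[mu]_(t in `]-oo, y]) gauss_fun t) (y : R) :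
  is_derive y 1 G (gauss_fun y).
Proof.
have [dG GE] : derivable G y 1 /\ derive1 G y = gauss_fun y.
  apply: (@continuous_FTC1 R (@gauss_fun R) -oo%O y (y + 1)).
  - by rewrite ltrDl.
  - exact: gauss_integrable.
  - by rewrite ltNyr.
  - exact: continuous_gauss_fun.
by apply: DeriveDef => //; rewrite -derive1E.
Qed.

Lemma cexpR (x : R) : cexp x%:C = (expR x)%:C.
Proof. by rewrite /cexp /= cos0 sin0 mulr1. Qed.

Lemma cerfcR (x : R) :
  cerfc x%:C =
  (2 / Num.sqrt pi * \int[mu]_(t in `[x, +oo[) expR (- t ^+ 2))%:C.
Proof.
pose G y : R := \int[mu]_(t in `]-oo, y]) gauss_fun t.
have dG (y : R) : is_derive y 1 G (gauss_fun y) by exact: gauss_primitive.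
have GT y : G y + \int[mu]_(t in `[y, +oo[) gauss_fun t = Num.sqrt pi.
  rewrite -Rintegral_itv_obnd_cbnd; last exact: gauss_integrable.
  rewrite /G -Rintegral_setU//=.
  - rewrite -itv_bndbnd_setU// set_itvNyy.
    by rewrite /Rintegral integralT_gauss.
  - exact: gauss_integrable (measurableU _ _ _ _).
  - apply/disj_set2P/seteqP; split => // t /=; rewrite !in_itv/= andbT.
    by move=> [ty yt]; have := lt_le_trans yt ty; rewrite ltxx.
have G0 : G 0 = Num.sqrt pi / 2.
  have := GT 0; rewrite [X in _ + X]/Rintegral integral0y_gauss /=.
  by move=> /eqP; rewrite eq_sym -subr_eq => /eqP <-; field.
pose F t := G (t * x).
have dF (t : R) : is_derive t 1 F (x * gauss_fun (t * x)).
  have dt : is_derive t 1 (fun t : R => t * x) x.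
    by apply: is_derive_eq; rewrite scaler0 add0r /GRing.scale /= mulr1.
  by rewrite mulrC; exact: (is_derive1_comp (dG _) dt).
have cg : continuous (fun t : R => gauss_fun (t * x)).
  move=> t; apply: continuous_comp; last exact: continuous_gauss_fun.
  by apply: cvgMl; exact: cvg_id.
have ig : mu.-integrable `[0, 1] (EFin \o (fun t => gauss_fun (t * x))).
  apply: continuous_compact_integrable; first exact: segment_compact.
  by apply: continuous_subspaceT.
have int01 : x * \int[mu]_(t in `[0, 1]) gauss_fun (t * x) = G x - G 0.
  rewrite -RintegralZl// /Rintegral.
  rewrite (@continuous_FTC2 _ _ F)//.
  - by rewrite /F mul1r mul0r.
  - by apply: continuous_subspaceT => t; apply: cvgMr; exact: cg.
  - have cF t : F @ t --> F t.
      by apply/differentiable_continuous/derivable1_diffP; apply: ex_derive.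
    split => [t _||]; first exact: ex_derive.
      exact: cvg_at_right_filter.
    exact: cvg_at_left_filter.
  - by move=> t _; rewrite derive1E; exact: derive_val.
have fE t : cexp (- (t%:C * x%:C) ^+ 2) = (gauss_fun (t * x))%:C.
  by rewrite -rmorphM -rmorphXn -rmorphN cexpR.
rewrite /cerfc.
under eq_Rintegral do rewrite fE /=.
under [X in _ +i* X]eq_Rintegral do rewrite fE /=.
rewrite Rintegral_cst// mul0r -/(real_complex _ _).
rewrite -!rmorphM -(rmorph1 (real_complex R)) -rmorphB -mulrA int01 G0.
congr (_%:C); rewrite -/(gauss_fun _).
have spi : Num.sqrt pi != 0 :> R by rewrite gt_eqF// sqrtr_gt0 pi_gt0.
have -> : \int[mu]_(t in `[x, +oo[) expR (- t ^+ 2) = Num.sqrt pi - G x.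
  by rewrite -(GT x) addrC addKr.
by field.
Qed.

End ginibre.

(* Main.v *)
Require Import Defs.
From mathcomp Require Import all_boot all_order all_algebra.
From mathcomp Require Import complex.
From mathcomp Require Import all_classical all_reals all_analysis.
From mathcomp Require Import ring lra measurable_realfun.

(* Writing the squared Vandermonde determinant as a Gram determinant gives
   Omega_N(z) = prod_l (pi l!) * det [K_N(z_i, z_j)], with the kernel
     K_N(z, w) = 1/pi exp(-|z|^2/2 - |w|^2/2) sum_(l < N) (z conj(w))^l / l!.
   By the moments of exp(-|z|^2), K_N reproduces itself and has trace N, so
   integrating out one variable of det K_N of size n + 1 leaves (N - n) det K_N of
   size n; hence R_n = det [K_N(z_i, z_j)].

   At z = u sqrt N + s the kernel is, up to a conjugation by a diagonal matrix of
   phases, 1/pi times the limiting Gaussian kernel times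
     h_N(zeta) = truncexp N zeta = exp(-zeta) sum_(l < N) zeta^l / l!  at zeta = z conj(w),
   and h_N' is explicit: -exp(-zeta) zeta^(N-1) / (N-1)!.  If |u| < 1 then
   h_N(zeta) --> 1 by a Chernoff bound on this derivative between 0 and zeta.
   If |u| = 1 one integrates it from M = N - 1 to zeta = M + a sqrt(2M): after
   rescaling it tends to a Gaussian, which yields erfc(a) / 2.  Both the constant in
   front (Stirling's formula) and the value h_(M+1)(M) --> 1/2 follow from dominated
   convergence on the two half-lines, where the total masses are known. *)

Set Implicit Arguments.
Unset Strict Implicit.
Unset Printing Implicit Defensive.

Import Order.TTheory GRing.Theory Num.Theory.
Import numFieldNormedType.Exports.

Local Open Scope classical_set_scope.
Local Open Scope complex_scope.
Local Open Scope ring_scope.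

(** All the analysis is one-variable calculus along straight lines, with real and imaginary parts
    treated separately. The planar moments come from integrating directional derivatives over
    horizontal and vertical lines, without polar coordinates; the limits of [truncexp] come from its
    derivative along segments. The scale at the edge is dictated by log(1 + x) - x ~ - x^2 / 2: with
    x = [gscale M] w and M x^2 = 2 w^2, the M-th power of (1 + x) exp(-x) tends to exp(-w^2). On the
    real axis, its masses to the right and to the left of M, times one common constant, are h(M) and
    1 - h(M). Their sum determines the constant, which is how Stirling's formula is obtained rather
    than assumed. The delicate domination is on the right half-line: there the M-th power has only
    an exponential tail, so the dominating function is exponential, although the limit is Gaussian.
    In the determinantal part, the variable to be integrated is placed in the border of the matrix.
    It then enters only through K(x, x) and the products K(z_j, x) K(x, z_i), whose integrals are
    known. *)

Local Notation Re := complex.Re.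
Local Notation Im := complex.Im.
Local Notation normc := Normc.normc.

(** * Complex arithmetic, modulus and exponential *)

Section complex_numbers.
Variable R : realType.
Local Notation C := R[i].
Implicit Types x y z : C.

Lemma ReD x y : Re (x + y) = Re x + Re y. Proof. by case: x; case: y. Qed.
Lemma ImD x y : Im (x + y) = Im x + Im y. Proof. by case: x; case: y. Qed.
Lemma ReN x : Re (- x) = - Re x. Proof. by case: x. Qed.
Lemma ImN x : Im (- x) = - Im x. Proof. by case: x. Qed.
Lemma ReM x y : Re (x * y) = Re x * Re y - Im x * Im y.
Proof. by case: x; case: y. Qed.
Lemma ImM x y : Im (x * y) = Re x * Im y + Im x * Re y.
Proof. by case: x; case: y. Qed.
Lemma ReMr (r : R) x : Re (r%:C * x) = r * Re x.
Proof. by rewrite ReM /= mul0r subr0. Qed.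
Lemma ReJ x : Re (conjc x) = Re x. Proof. by case: x. Qed.
Lemma ImJ x : Im (conjc x) = - Im x. Proof. by case: x. Qed.

Lemma complex_ext x y : Re x = Re y -> Im x = Im y -> x = y.
Proof. by case: x y => a b [c d] /= -> ->. Qed.

Lemma normc_ge0 x : 0 <= normc x.
Proof. by case: x => a b; rewrite /= sqrtr_ge0. Qed.

Lemma normc_sqr x : normc x ^+ 2 = Re x ^+ 2 + Im x ^+ 2.
Proof. by case: x => a b; rewrite /= sqr_sqrtr// addr_ge0// sqr_ge0. Qed.

Lemma normr_normc x : `|x| = (normc x)%:C.
Proof. by rewrite normc_def; case: x. Qed.

Lemma normc_real (r : R) : normc r%:C = `|r|.
Proof. by rewrite /= expr0n /= addr0 sqrtr_sqr. Qed.

Lemma normcX x n : normc (x ^+ n) = normc x ^+ n.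
Proof.
elim: n => [|n IH]; first by rewrite !expr0 Normc.normc1.
by rewrite !exprS Normc.normcM IH.
Qed.

Lemma normcJ_eq x : normc (conjc x) = normc x.
Proof. by case: x => a b; rewrite /= sqrrN. Qed.

Lemma normc_Re x : `|Re x| <= normc x.
Proof.
rewrite -(@ler_pXn2r _ 2)// ?nnegrE ?normc_ge0// normc_sqr real_normK ?num_real//.
by rewrite lerDl sqr_ge0.
Qed.

Lemma normc_Im x : `|Im x| <= normc x.
Proof.
rewrite -(@ler_pXn2r _ 2)// ?nnegrE ?normc_ge0// normc_sqr real_normK ?num_real//.
by rewrite lerDr sqr_ge0.
Qed.

Lemma normc_le_ReIm x : normc x <= `|Re x| + `|Im x|.
Proof.
rewrite -(@ler_pXn2r _ 2)// ?nnegrE ?normc_ge0 ?addr_ge0// normc_sqr.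
rewrite sqrrD !real_normK ?num_real// -addrA lerD2l lerDr mulrn_wge0// mulr_ge0.
Qed.

Lemma mulcJ x : x * conjc x = (normc x ^+ 2)%:C.
Proof. by rewrite -sqr_normc normr_normc rmorphXn. Qed.

Lemma cexpD x y : cexp (x + y) = cexp x * cexp y.
Proof.
rewrite /cexp ReD ImD expRD cosD sinD; apply: complex_ext;
  rewrite !(ReM, ImM) /=; ring.
Qed.

Lemma cexp0 : cexp 0 = 1 :> C.
Proof. by rewrite (_ : 0 = 0%:C)// cexpR expR0. Qed.

Lemma cexpNM x : cexp (- x) * cexp x = 1.
Proof. by rewrite -cexpD addNr cexp0. Qed.

Lemma cexp_neq0 x : cexp x != 0.
Proof.
apply/eqP => h; have := cexpNM x; rewrite h mulr0 => /eqP.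
by rewrite eq_sym oner_eq0.
Qed.

Lemma cexpN x : cexp (- x) = (cexp x)^-1.
Proof.
by apply: (mulIf (cexp_neq0 x)); rewrite cexpNM mulVf// cexp_neq0.
Qed.

Lemma cexpX x n : cexp x ^+ n = cexp (n%:R * x).
Proof.
elim: n => [|n IH]; first by rewrite expr0 mul0r cexp0.
by rewrite exprS IH -cexpD -{1}(mul1r x) -mulrDl -natr1 addrC.
Qed.

Lemma normc_cexp x : normc (cexp x) = expR (Re x).
Proof.
rewrite /cexp Normc.normcM normc_real ger0_norm ?expR_ge0//.
by rewrite /= cos2Dsin2 sqrtr1 mulr1.
Qed.

Lemma conj_cexp x : conjc (cexp x) = cexp (conjc x).
Proof.
rewrite /cexp ReJ ImJ cosN sinN.
apply: complex_ext; rewrite ?ReJ ?ImJ !(ReM, ImM) /=; ring.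
Qed.

Lemma natc (n : nat) : (n%:R : C) = (n%:R)%:C.
Proof. by rewrite rmorph_nat. Qed.

End complex_numbers.

(** * Limits of complex sequences *)

Section complex_limits.
Variable R : realType.
Local Notation C := R[i].
Implicit Types (f g : nat -> C) (k l : C).

(** Working by components keeps the limit theorems over [R] directly available; [ccvg_cvg] passes to
    the norm of [R[i]] only for the final statement. *)
Definition ccvg f l := (Re (f n) @[n --> \oo] --> Re l) /\
                       (Im (f n) @[n --> \oo] --> Im l).

Lemma ccvg_cst l : ccvg (fun=> l) l.
Proof. by split; exact: cvg_cst. Qed.

Lemma ccvg_real (f : nat -> R) (l : R) :
  f n @[n --> \oo] --> l -> ccvg (fun n => (f n)%:C) l%:C.
Proof. by move=> h; split=> //=; exact: cvg_cst. Qed.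

Lemma eq_ccvg f g l : f =1 g -> ccvg f l -> ccvg g l.
Proof. by move=> /funext ->. Qed.

Lemma ccvgD f g k l : ccvg f k -> ccvg g l -> ccvg (fun n => f n + g n) (k + l).
Proof.
move=> [f1 f2] [g1 g2]; split; rewrite (ReD, ImD).
  by under eq_fun do rewrite ReD; exact: cvgD.
by under eq_fun do rewrite ImD; exact: cvgD.
Qed.

Lemma ccvgN f k : ccvg f k -> ccvg (fun n => - f n) (- k).
Proof.
move=> [f1 f2]; split; rewrite (ReN, ImN).
  by under eq_fun do rewrite ReN; exact: cvgN.
by under eq_fun do rewrite ImN; exact: cvgN.
Qed.

Lemma ccvgB f g k l : ccvg f k -> ccvg g l -> ccvg (fun n => f n - g n) (k - l).
Proof. by move=> hf hg; apply: ccvgD => //; exact: ccvgN. Qed.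

Lemma ccvgM f g k l : ccvg f k -> ccvg g l -> ccvg (fun n => f n * g n) (k * l).
Proof.
move=> [f1 f2] [g1 g2]; split; rewrite (ReM, ImM).
  by under eq_fun do rewrite ReM; apply: cvgB; exact: cvgM.
by under eq_fun do rewrite ImM; apply: cvgD; exact: cvgM.
Qed.

Lemma ccvg_sum I (r : seq I) (F : I -> nat -> C) (L : I -> C) :
  (forall i, ccvg (F i) (L i)) ->
  ccvg (fun n => \sum_(i <- r) F i n) (\sum_(i <- r) L i).
Proof.
move=> h; elim: r => [|i r IH].
  by under eq_fun do rewrite big_nil; rewrite big_nil; exact: ccvg_cst.
by under eq_fun do rewrite big_cons; rewrite big_cons; exact: ccvgD.
Qed.

Lemma ccvg_prod I (r : seq I) (F : I -> nat -> C) (L : I -> C) :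
  (forall i, ccvg (F i) (L i)) ->
  ccvg (fun n => \prod_(i <- r) F i n) (\prod_(i <- r) L i).
Proof.
move=> h; elim: r => [|i r IH].
  by under eq_fun do rewrite big_nil; rewrite big_nil; exact: ccvg_cst.
by under eq_fun do rewrite big_cons; rewrite big_cons; exact: ccvgM.
Qed.

Lemma ccvg_det m (A : nat -> 'M[C]_m) (L : 'M[C]_m) :
  (forall i j, ccvg (fun n => A n i j) (L i j)) ->
  ccvg (fun n => \det (A n)) (\det L).
Proof.
move=> h; apply: ccvg_sum => s; apply: ccvgM; first exact: ccvg_cst.
by apply: ccvg_prod => i; exact: h.
Qed.

Lemma ccvg_cexp f l : ccvg f l -> ccvg (fun n => cexp (f n)) (cexp l).
Proof.
move=> [f1 f2]; apply: ccvgM.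
  by apply: ccvg_real; apply: continuous_cvg => //; exact: continuous_expR.
split=> /=.
  by apply: continuous_cvg => //; exact: continuous_cos.
by apply: continuous_cvg => //; exact: continuous_sin.
Qed.

Lemma ccvg_normc f l : ccvg f l -> normc (f n) @[n --> \oo] --> normc l.
Proof.
move=> [f1 f2]; rewrite (_ : normc l = Num.sqrt (Re l ^+ 2 + Im l ^+ 2));
  last by case: l {f1 f2}.
rewrite (_ : (fun n => normc (f n)) = (fun n => Num.sqrt (Re (f n) ^+ 2 + Im (f n) ^+
  2))); last first.
  by apply/funext => n; case: (f n).
apply: continuous_cvg; first exact: sqrt_continuous.
by apply: cvgD; apply: cvgM.
Qed.

Lemma normc_ccvg f l : normc (f n - l) @[n --> \oo] --> (0:R) -> ccvg f l.
Proof.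
move=> h; split; apply/cvgrPdist_lt => e e0; move/cvgrPdist_lt/(_ e e0) : h;
  apply: filterS => n; rewrite sub0r normrN ger0_norm ?normc_ge0//;
  apply: le_lt_trans.
- by rewrite distrC -ReN -ReD; exact: normc_Re.
- by rewrite distrC -ImN -ImD; exact: normc_Im.
Qed.

Lemma ccvg_cvg f l : ccvg f l -> (f : nat -> R[i]^o) @ \oo --> (l : R[i]^o).
Proof.
move=> fl; apply/cvgrPdist_lt => e e0.
(* In the partial order of [R[i]] a positive element is real. *)
have [E eE] : exists E : R, e = E%:C.
  by exists (Re e); rewrite RRe_real// ger0_real// ltW.
rewrite eE ltcR in e0 *.
have := ccvg_normc (ccvgB (ccvg_cst l) fl).
rewrite subrr Normc.normc0 => /cvgrPdist_lt/(_ E e0).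
apply: filterS => n; rewrite sub0r normrN ger0_norm ?normc_ge0//.
by move=> h; rewrite [X in X < _]normr_normc ltcR.
Qed.

End complex_limits.

(** * Derivatives of complex-valued functions of a real variable *)

Section complex_derivatives.
Variable R : realType.
Local Notation C := R[i].
Implicit Types (f g : R -> C) (x t : R) (a b d : C).

Definition cderiv f x d :=
  is_derive x 1 (fun t => Re (f t)) (Re d) /\
  is_derive x 1 (fun t => Im (f t)) (Im d).

Lemma cderiv_eq f x d d' : cderiv f x d -> d = d' -> cderiv f x d'.
Proof. by move=> h <-. Qed.

Lemma cderiv_cst a x : cderiv (fun=> a) x 0.
Proof. by split; exact: is_derive_cst. Qed.

Lemma cderiv_real (f : R -> R) x (d : R) : is_derive x 1 f d ->
  cderiv (fun t => (f t)%:C) x d%:C.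
Proof. by move=> h; split=> //=; exact: is_derive_cst. Qed.

Lemma cderiv_id x : cderiv (fun t => t%:C) x 1.
Proof. by apply: (@cderiv_real id x 1); exact: is_derive_id. Qed.

Lemma cderivD f g x a b : cderiv f x a -> cderiv g x b ->
  cderiv (fun t => f t + g t) x (a + b).
Proof.
move=> [f1 f2] [g1 g2]; split; rewrite (ReD, ImD).
  by under eq_fun do rewrite ReD; exact: is_deriveD.
by under eq_fun do rewrite ImD; exact: is_deriveD.
Qed.

Lemma cderivN f x a : cderiv f x a -> cderiv (fun t => - f t) x (- a).
Proof.
move=> [f1 f2]; split; rewrite (ReN, ImN).
  by under eq_fun do rewrite ReN; exact: is_deriveN.
by under eq_fun do rewrite ImN; exact: is_deriveN.
Qed.

Lemma cderivM f g x a b : cderiv f x a -> cderiv g x b ->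
  cderiv (fun t => f t * g t) x (a * g x + f x * b).
Proof.
move=> [f1 f2] [g1 g2]; split; rewrite !(ReM, ReD, ImM, ImD).
  under eq_fun do rewrite ReM; apply: is_derive_eq.
  by rewrite /GRing.scale /=; ring.
under eq_fun do rewrite ImM; apply: is_derive_eq.
by rewrite /GRing.scale /=; ring.
Qed.

Lemma cderivX f x a n : cderiv f x a ->
  cderiv (fun t => f t ^+ n) x (n%:R * f x ^+ n.-1 * a).
Proof.
move=> h; elim: n => [|n IH].
  by under eq_fun do rewrite expr0; rewrite !mul0r; exact: cderiv_cst.
under eq_fun do rewrite exprS; apply: cderiv_eq (cderivM h IH) _ => /=.
case: n {IH} => [|n] /=; first by rewrite expr0 !mul0r mulr0 addr0 !mulr1 mul1r.
by rewrite exprS; ring.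
Qed.

Lemma cderiv_cexp f x a : cderiv f x a ->
  cderiv (fun t => cexp (f t)) x (cexp (f x) * a).
Proof.
move=> [f1 f2]; apply: cderiv_eq.
  apply: cderivM; first by apply: cderiv_real; apply: is_derive1_comp.
  have : cderiv (fun t => cos (Im (f t)) +i* sin (Im (f t))) x
      ((- sin (Im (f x)) * Im a) +i* (cos (Im (f x)) * Im a)).
    by split=> /=; apply: is_derive1_comp.
  exact.
rewrite /cexp /=.
apply: complex_ext; rewrite !(ReM, ImM, ReD, ImD) /=; ring.
Qed.

Lemma cderiv_continuous f x d : cderiv f x d ->
  continuous_at x (fun t => Re (f t)) /\ continuous_at x (fun t => Im (f t)).
Proof.
move=> [f1 f2]; split; apply: differentiable_continuous; apply/derivable1_diffP;
  exact: ex_derive.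
Qed.

(* The real mean value theorem does not hold for complex-valued functions; it is
   applied to the real and imaginary parts separately, hence the factor 2. *)
Lemma complex_mean_value f (f' : R -> C) (B : R) :
  (forall t, cderiv f t (f' t)) ->
  (forall t, 0 <= t <= 1 -> normc (f' t) <= B) ->
  normc (f 1 - f 0) <= 2 * B.
Proof.
move=> df fB.
have MV (g g' : R -> R) : (forall t, is_derive t (1:R) g (g' t)) ->
    (forall t, 0 <= t <= 1 -> `|g' t| <= B) -> `|g 1 - g 0| <= B.
  move=> dg gB.
  have [] := @MVT_segment R g g' 0 1 ler01 (fun t _ => dg t).
    apply: continuous_subspaceT => t; apply: differentiable_continuous.
    by apply/derivable1_diffP; case: (dg t).
  move=> c; rewrite in_itv /= => /gB cB ->.
  by rewrite subr0 mulr1.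
apply: le_trans (normc_le_ReIm _) _; rewrite mulr_natl mulr2n.
rewrite ReD ImD ReN ImN; apply: lerD.
  apply: (MV (fun t => Re (f t)) (fun t => Re (f' t))) => t; first by have [] := df t.
  by move=> /fB; apply: le_trans; exact: normc_Re.
apply: (MV (fun t => Im (f t)) (fun t => Im (f' t))) => t; first by have [] := df t.
by move=> /fB; apply: le_trans; exact: normc_Im.
Qed.

End complex_derivatives.

(** * The truncated exponential, and estimates on (1 + x) exp(-x) *)

Section truncated_exponential.
Variable R : realType.
Local Notation C := R[i].
Implicit Types (z w x a d : C) (t : R).

Definition truncexp n z : C := cexp (- z) * \sum_(l < n) z ^+ l / (l`!)%:R.

Lemma truncexpS n z :
  truncexp n.+1 z = truncexp n z + cexp (- z) * (z ^+ n / (n`!)%:R).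
Proof. by rewrite /truncexp big_ord_recr /= mulrDr. Qed.

Lemma factc_neq0 n : (n`!%:R : C) != 0.
Proof. by rewrite pnatr_eq0 -lt0n fact_gt0. Qed.

(** The derivative of exp(-f) f^l / l! is a difference of two consecutive terms, so the sum
    telescopes and only its last term survives. *)
Lemma cderiv_truncexp (f : R -> C) n t d : cderiv f t d ->
  cderiv (fun s => truncexp n.+1 (f s)) t
    (- (cexp (- f t) * (f t ^+ n / (n`!)%:R) * d)).
Proof.
move=> fd; have de := cderiv_cexp (cderivN fd).
elim: n => [|n IH].
  under eq_fun do rewrite truncexpS {1}/truncexp big_ord0 mulr0 add0r expr0 fact0 divr1
    mulr1.
  by apply: cderiv_eq de _; rewrite expr0 fact0; field.
under eq_fun do rewrite truncexpS.
apply: cderiv_eq (cderivD IH (cderivM de (cderivM (cderivX n.+1 fd) (cderiv_cst _ _)))) _.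
rewrite /= factS natrM exprS; field.
by rewrite factc_neq0 nat1r pnatr_eq0.
Qed.

(** After squaring, this is |1 + x|^2 = 1 + 2 Re x + |x|^2 <= exp(2 Re x + |x|^2), an instance of 1
    + y <= exp y. *)
Lemma normc_1Dx_cexp x :
  normc ((1 + x) * cexp (- x)) <= expR (normc x ^+ 2 / 2).
Proof.
rewrite -(@ler_pXn2r _ 2)// ?nnegrE ?normc_ge0 ?expR_ge0//.
rewrite Normc.normcM normc_cexp exprMn !normc_sqr ReN ReD ImD /= add0r.
rewrite -!expRM_natl -ler_pdivlMr ?expR_gt0// -expRN -expRD.
apply: le_trans (expR_ge1Dx _).
by rewrite le_eqVlt; apply/orP; left; apply/eqP; field.
Qed.

(* With [psi t = (1 + t x) exp (- t x + t^2 x^2 / 2)], the derivative of [psi] is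
   [t^2 x^3 exp (- t x + t^2 x^2 / 2)]. *)
Lemma normc_1Dx_cexpB x :
  normc ((1 + x) * cexp (- x) - cexp (- (x ^+ 2 / 2))) <=
  2 * normc x ^+ 3 * expR (normc x + normc x ^+ 2).
Proof.
pose psi t := (1 + t%:C * x) * cexp (- (t%:C * x) + (t%:C * x) ^+ 2 / 2).
pose psi' t := (t%:C ^+ 2 * x ^+ 3) * cexp (- (t%:C * x) + (t%:C * x) ^+ 2 / 2).
have dpsi t : cderiv psi t (psi' t).
  have dx := cderivM (cderiv_id t) (cderiv_cst x t).
  apply: cderiv_eq.
    apply: cderivM; first exact: cderivD (cderiv_cst _ _) dx.
    apply: cderiv_cexp; apply: cderivD; first exact: cderivN dx.
    by apply: cderivM; [exact: cderivX dx | exact: cderiv_cst].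
  by rewrite /psi' /= expr1; field.
have := @complex_mean_value R psi psi' (normc x ^+ 3 * expR (normc x + normc x ^+ 2 / 2))
  dpsi.
rewrite {1}/psi mul1r {1}/psi mul0r oppr0 expr0n /= mul0r addr0 add0r cexp0 mulr1 => H.
have {H} : normc ((1 + x) * cexp (- x + x ^+ 2 / 2) - 1) <=
    2 * (normc x ^+ 3 * expR (normc x + normc x ^+ 2 / 2)).
  apply: H => t /andP[t0 t1]; rewrite /psi' Normc.normcM (Normc.normcM (_ ^+ 2)).
  rewrite !normcX normc_real ger0_norm//.
  apply: ler_pM; rewrite ?mulr_ge0 ?exprn_ge0 ?normc_ge0//.
    by rewrite ler_piMl ?exprn_ge0 ?normc_ge0// exprn_ile1.
  rewrite normc_cexp ler_expR ReD; apply: lerD.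
    apply: le_trans (ler_norm _) _; apply: le_trans (normc_Re _) _.
    by rewrite normcN Normc.normcM normc_real ger0_norm// ler_piMl ?normc_ge0.
  apply: le_trans (ler_norm _) _; apply: le_trans (normc_Re _) _.
  rewrite Normc.normcM normcX Normc.normcM normc_real ger0_norm// Normc.normcV.
  rewrite natc normc_real ger0_norm// ler_pM2r// exprMn ler_piMl ?exprn_ge0 ?normc_ge0//.
  by rewrite exprn_ile1.
move=> H.
(* The difference is exp(- x^2 / 2) (psi 1 - psi 0); the modulus of the prefactor supplies the
   second half of |x|^2 in the exponent. *)
have -> : (1 + x) * cexp (- x) - cexp (- (x ^+ 2 / 2)) =
    cexp (- (x ^+ 2 / 2)) * ((1 + x) * cexp (- x + x ^+ 2 / 2) - 1).
  by rewrite mulrBr mulr1 [in RHS]mulrCA -cexpD; congr (_ * cexp _ - _); ring.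
rewrite Normc.normcM normc_cexp.
have -> : normc x + normc x ^+ 2 = normc x ^+ 2 / 2 + (normc x + normc x ^+ 2 / 2) by field.
rewrite expRD -mulrA [X in 2 * X]mulrCA [X in _ <= X]mulrCA.
apply: ler_pM; rewrite ?expR_ge0 ?normc_ge0//.
rewrite ler_expR; apply: le_trans (ler_norm _) _; apply: le_trans (normc_Re _) _.
rewrite normcN Normc.normcM normcX Normc.normcV.
by rewrite natc normc_real ger0_norm.
Qed.

(** Induction on p^(M+1) - q^(M+1) = p (p^M - q^M) + (p - q) q^M. Since 1 <= r, the exponent M can
    stand for the sharper M - 1, which avoids a predecessor. *)
Lemma normcXB p q (r : R) M : 1 <= r -> normc p <= r -> normc q <= r ->
  normc (p ^+ M - q ^+ M) <= M%:R * normc (p - q) * r ^+ M.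
Proof.
move=> r1 pr qr; have r0 : 0 <= r by exact: le_trans r1.
elim: M => [|M IH]; first by rewrite !expr0 subrr Normc.normc0 !mul0r.
have -> : p ^+ M.+1 - q ^+ M.+1 = p * (p ^+ M - q ^+ M) + (p - q) * q ^+ M.
  by rewrite !exprS; ring.
apply: le_trans (le_normcD _ _) _; rewrite !Normc.normcM normcX.
have -> : M.+1%:R * normc (p - q) * r ^+ M.+1 =
   r * (M%:R * normc (p - q) * r ^+ M) + normc (p - q) * r ^+ M.+1.
  by rewrite exprS; ring.
apply: lerD; first by apply: ler_pM; rewrite ?normc_ge0.
rewrite ler_wpM2l ?normc_ge0//; apply: le_trans (_ : r ^+ M <= _).
  by apply: lerXn2r; rewrite ?nnegrE ?normc_ge0.
by rewrite exprS ler_peMl// exprn_ge0.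
Qed.

End truncated_exponential.

(** * Rescaling the derivative of the truncated exponential around M *)

Section gaussian_rescaling.
Variable R : realType.
Local Notation C := R[i].
Local Notation mu := (@lebesgue_measure R).
Implicit Types (z w x a d : C) (t v : R) (M : nat).

(* Along the path [M + sqrt (2 M) w], where [sqrt (2 M) = M * gscale M], the derivative
   of [truncexp M.+1] is [- gconst M * gratio M w]; [rratio] is [gratio] on the reals. *)
Definition gscale M : R := Num.sqrt (2 / M%:R).
Definition gratio M w : C :=
  ((1 + (gscale M)%:C * w) * cexp (- ((gscale M)%:C * w))) ^+ M.
Definition rratio M v : R := ((1 + gscale M * v) * expR (- (gscale M * v))) ^+ M.
Definition gconst M : R :=
  gscale M * M%:R * expR (- M%:R) * M%:R ^+ M / M`!%:R.

Lemma gscale_ge0 M : 0 <= gscale M. Proof. exact: sqrtr_ge0. Qed.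

Lemma gscale_gt0 M : (0 < M)%N -> 0 < gscale M.
Proof. by move=> M0; rewrite sqrtr_gt0 divr_gt0// ltr0n. Qed.

Lemma gscale_sqr M : (0 < M)%N -> M%:R * gscale M ^+ 2 = 2.
Proof.
move=> M0; rewrite sqr_sqrtr ?divr_ge0//; field.
by rewrite pnatr_eq0 -lt0n.
Qed.

Lemma gscale_le2 M : (0 < M)%N -> gscale M <= 2.
Proof.
move=> M0; rewrite -(@ler_pXn2r _ 2)// ?nnegrE ?gscale_ge0//.
have M1 : 1 <= M%:R :> R by rewrite ler1n.
have := gscale_sqr M0; have := sqr_ge0 (gscale M).
rewrite (_ : 2 ^+ 2 = 4); last by ring.
nra.
Qed.

Lemma cvg_gscale : gscale n.+1 @[n --> \oo] --> (0:R).
Proof.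
rewrite -[X in _ --> X]sqrtr0 /gscale; apply: continuous_cvg; first exact: sqrt_continuous.
rewrite -[X in _ --> X](mulr0 2); apply: cvgM; first exact: cvg_cst.
exact: cvg_harmonic.
Qed.

Lemma gratio_real M v : gratio M v%:C = (rratio M v)%:C.
Proof.
by rewrite /gratio /rratio !(rmorphXn, rmorphM, rmorphD) /= -cexpR rmorphN !rmorphM.
Qed.

(** With x = [gscale M] w, the bound exp(|x|^2 / 2) on the base becomes free of M after the M-th
    power. It serves as the dominating function on complex segments. *)
Lemma normc_gratio M w : (0 < M)%N -> normc (gratio M w) <= expR (normc w ^+ 2).
Proof.
move=> M0; rewrite normcX; apply: le_trans (_ : expR (normc ((gscale M)%:C * w) ^+ 2 / 2)
  ^+ M <= _).
  by apply: lerXn2r; rewrite ?nnegrE ?normc_ge0 ?expR_ge0 ?normc_1Dx_cexp.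
rewrite -expRM_natl ler_expR Normc.normcM normc_real ger0_norm ?gscale_ge0//.
by rewrite exprMn mulrA mulrA gscale_sqr// mulrAC divff ?mul1r.
Qed.

(** Both sides are M-th powers with bases bounded by exp(|x|^2 / 2), where x = [gscale M] w. The
    bases differ by O(|x|^3), and since M |x|^2 = 2 |w|^2, the M-fold error 2 M |x|^3 is 4
    [gscale M] |w|^3, which vanishes with [gscale M]. *)
Lemma gratio_approx M w : (0 < M)%N ->
  normc (gratio M w - cexp (- w ^+ 2)) <=
  4 * gscale M * normc w ^+ 3 * expR (2 * normc w + 3 * normc w ^+ 2).
Proof.
move=> M0; set x := (gscale M)%:C * w.
have xE : normc x = gscale M * normc w.
  by rewrite Normc.normcM normc_real ger0_norm ?gscale_ge0.
have x2E : M%:R * normc x ^+ 2 = 2 * normc w ^+ 2.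
  by rewrite xE exprMn mulrA gscale_sqr.
have M1 : 1 <= M%:R :> R by rewrite ler1n.
have -> : cexp (- w ^+ 2) = cexp (- (x ^+ 2 / 2)) ^+ M.
  rewrite cexpX; congr cexp.
  rewrite mulrN; congr (- _); rewrite /x exprMn -rmorphXn /= mulrA mulrA natc -rmorphM.
  by rewrite gscale_sqr// rmorph_nat mulrAC divff ?mul1r// pnatr_eq0.
have qb : normc (cexp (- (x ^+ 2 / 2))) <= expR (normc x ^+ 2 / 2).
  rewrite normc_cexp ler_expR; apply: le_trans (ler_norm _) _;
    apply: le_trans (normc_Re _) _.
  by rewrite normcN Normc.normcM normcX Normc.normcV natc normc_real ger0_norm.
have r1 : 1 <= expR (normc x ^+ 2 / 2).
  by rewrite -[X in X <= _]expR0 ler_expR divr_ge0 ?exprn_ge0 ?normc_ge0.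
apply: le_trans (normcXB M r1 (normc_1Dx_cexp x) qb) _.
have -> : expR (normc x ^+ 2 / 2) ^+ M = expR (normc w ^+ 2).
  by rewrite -expRM_natl; congr expR; rewrite mulrA x2E; field.
apply: le_trans (_ : M%:R * (2 * normc x ^+ 3 * expR (normc x + normc x ^+ 2)) * expR
  (normc w ^+ 2) <= _).
  rewrite ler_wpM2r ?expR_ge0// ler_wpM2l//; exact: normc_1Dx_cexpB.
have -> : M%:R * (2 * normc x ^+ 3 * expR (normc x + normc x ^+ 2)) =
    2 * (M%:R * normc x ^+ 2) * normc x * expR (normc x + normc x ^+ 2) by ring.
rewrite x2E xE -mulrA -expRD.
have -> : 2 * (2 * normc w ^+ 2) * (gscale M * normc w) = 4 * gscale M * normc w ^+ 3 by
  ring.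
rewrite ler_wpM2l ?mulr_ge0 ?exprn_ge0 ?normc_ge0 ?gscale_ge0// ler_expR -addrA.
have := gscale_le2 M0; have := normc_ge0 w; move: (gscale_ge0 M) x2E; rewrite xE.
move=> g0 x2E w0 g2; apply: lerD; first by nra.
have : (gscale M * normc w) ^+ 2 <= 2 * normc w ^+ 2.
  by rewrite -x2E ler_peMl ?exprn_ge0 ?mulr_ge0.
by nra.
Qed.

(** The argument may move with n, because the endpoint of the rescaled segment at the edge does. *)
Lemma ccvg_gratio (w_ : nat -> C) w : ccvg w_ w ->
  ccvg (fun n => gratio n.+1 (w_ n)) (cexp (- w ^+ 2)).
Proof.
move=> ww; have nw := ccvg_normc ww.
have h : ccvg (fun n => gratio n.+1 (w_ n) - cexp (- w_ n ^+ 2)) 0.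
  apply: normc_ccvg; under eq_fun do rewrite subr0.
  apply: (@squeeze_cvgr _ _ _ _ (cst 0)
    (fun n => 4 * gscale n.+1 * normc (w_ n) ^+ 3 * expR (2 * normc (w_ n) + 3 * normc
      (w_ n) ^+ 2))).
  - by near=> n; rewrite /= normc_ge0 gratio_approx.
  - exact: cvg_cst.
  - rewrite -[X in _ --> X](mul0r (expR (2 * normc w + 3 * normc w ^+ 2))).
    apply: cvgM.
      rewrite -[X in _ --> X](mul0r (normc w ^+ 3)); apply: cvgM.
        by rewrite -[X in _ --> X](mulr0 4); apply: cvgM;
          [exact: cvg_cst|exact: cvg_gscale].
      exact: (cvgM nw (cvgM nw nw)).
    apply: continuous_cvg; first exact: continuous_expR.
    by apply: cvgD; apply: cvgM => //; [exact: cvg_cst|exact: cvg_cst|exact: (cvgM nw nw)].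
have h2 : ccvg (fun n => cexp (- w_ n ^+ 2)) (cexp (- w ^+ 2)).
  by apply: ccvg_cexp; apply: ccvgN; apply: ccvgM.
by have := ccvgD h h2; rewrite add0r; apply: eq_ccvg => n; rewrite subrK.
Unshelve. all: by end_near. Qed.

Lemma cvg_rratio v : rratio n.+1 v @[n --> \oo] --> gauss_fun v.
Proof.
have [+ _] := @ccvg_gratio (fun=> v%:C) _ (ccvg_cst _).
under eq_fun do rewrite gratio_real /=.
by rewrite -rmorphXn -rmorphN cexpR.
Qed.

Lemma continuous_gratio M a :
  continuous (fun t => Re (gratio M (t%:C * a))) /\
  continuous (fun t => Im (gratio M (t%:C * a))).
Proof.
suff h t : exists d, cderiv (fun t => gratio M (t%:C * a)) t d.
  by split=> t; have [d /cderiv_continuous[]] := h t.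
have dx := cderivM (cderiv_cst (gscale M)%:C t) (cderivM (cderiv_id t) (cderiv_cst a t)).
eexists; apply: cderivX; apply: cderivM (cderivD (cderiv_cst _ _) dx) _.
exact: cderiv_cexp (cderivN dx).
Qed.

Lemma continuous_rratio M : continuous (rratio M).
Proof.
rewrite (_ : rratio M = fun t => Re (gratio M (t%:C * 1))).
  by have [] := continuous_gratio M 1.
by apply/funext => t; rewrite mulr1 gratio_real.
Qed.

(** The path is M (1 + x) with x = [gscale M] t a, so exp(-M (1 + x)) (M (1 + x))^M splits into
    exp(-M) M^M and the factor [gratio]. *)
Lemma cderiv_truncexp_path M a t :
  cderiv (fun t => truncexp M.+1 (M%:R + (M%:R * gscale M)%:C * (t%:C * a))) t
    (- ((gconst M)%:C * gratio M (t%:C * a) * a)).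
Proof.
have dx := cderivM (cderiv_id t) (cderiv_cst a t).
have df := cderivD (cderiv_cst M%:R t) (cderivM (cderiv_cst (M%:R * gscale M)%:C t) dx).
apply: cderiv_eq (cderiv_truncexp M df) _ => /=.
rewrite /gconst /gratio exprMn cexpX; set x := (gscale M)%:C * _.
have -> : M%:R + (M%:R * gscale M)%:C * (t%:C * a) = M%:R * (1 + x) :> C.
  by rewrite mulrDr mulr1 rmorphM rmorph_nat -mulrA.
rewrite exprMn (mulrDr _ 1 x) [M%:R * 1]mulr1 opprD cexpD (mulrN _ x).
rewrite (_ : cexp (- M%:R : C) = (expR (- M%:R))%:C); last first.
  by rewrite natc -rmorphN cexpR.
rewrite !(rmorphM, fmorphV, rmorphXn, rmorph_nat) /=.
ring.
Qed.

Lemma truncexp_real n v : truncexp n v%:C =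
  (expR (- v) * \sum_(l < n) v ^+ l / (l`!)%:R)%:C.
Proof.
rewrite /truncexp -rmorphN cexpR rmorphM rmorph_sum /=.
by under [in RHS]eq_bigr do rewrite rmorphM rmorphXn fmorphV rmorph_nat.
Qed.

(** From exp v >= v^(l+1) / (l+1)!, each of the n terms is at most n / v, hence the sum at most n^2
    / v. *)
Lemma cvg_truncexp_pinfty n : Re (truncexp n t%:C) @[t --> +oo] --> (0:R).
Proof.
under eq_fun do rewrite truncexp_real /=.
apply/cvgrPdist_le => e e0; near=> v.
have v0 : 0 < v by near: v; apply: nbhs_pinfty_gt; rewrite num_real.
have ve : n%:R ^+ 2 / e <= v by near: v; apply: nbhs_pinfty_ge; rewrite num_real.
rewrite sub0r normrN ger0_norm; last first.
  by rewrite mulr_ge0 ?expR_ge0// sumr_ge0// => i _; rewrite divr_ge0 ?exprn_ge0// ltW.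
apply: le_trans (_ : n%:R ^+ 2 / v <= _); last first.
  by rewrite ler_pdivrMr// mulrC -ler_pdivrMr.
rewrite mulr_sumr; apply: le_trans (_ : \sum_(i < n) n%:R / v <= _); last first.
  by rewrite sumr_const card_ord -[_ *+ n]mulr_natl mulrA expr2.
apply: ler_sum => i _; rewrite expRN mulrC ler_pdivrMr ?expR_gt0//.
have := expR_ge1Dxn i (ltW v0); set b := v ^+ i.+1 / _ => hb.
have -> : v ^+ i / i`!%:R = i.+1%:R / v * b.
  rewrite /b factS natrM exprS; field.
  by rewrite nat1r !pnatr_eq0 -!lt0n fact_gt0 lt0r_neq0.
have v0' := ltW v0; apply: ler_pM; rewrite ?divr_ge0 ?exprn_ge0//.
  by rewrite ler_pM2r ?invr_gt0// ler_nat ltn_ord.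
by apply: le_trans hb; rewrite lerDr.
Unshelve. all: by end_near. Qed.

End gaussian_rescaling.
Arguments gscale {R}.
Arguments gconst {R}.

(** * Dominated convergence on the two half-lines *)

Section gaussian_limits.
Variable R : realType.
Local Notation C := R[i].
Local Notation mu := (@lebesgue_measure R).
Implicit Types (z w x a d : C) (t v : R) (M : nat).

Lemma Rintegral_dominated_convergence (D : set R) (f_ : nat -> R -> R) (f g : R -> R) :
  measurable D -> (forall n, measurable_fun D (f_ n)) -> measurable_fun D f ->
  (forall t, D t -> f_ n t @[n --> \oo] --> f t) ->
  mu.-integrable D (EFin \o g) ->
  (forall n t, D t -> `|f_ n t| <= g t) ->
  \int[mu]_(t in D) f_ n t @[n --> \oo] --> \int[mu]_(t in D) f t.
Proof.
move=> mD mf_ mf cf ig fg.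
have [|||||If _] := @dominated_convergence _ _ _ mu D mD (fun n => EFin \o f_ n) (EFin \o
  f) (EFin \o g).
- by move=> n; apply/measurable_EFinP; exact: mf_.
- by apply/measurable_EFinP; exact: mf.
- apply: aeW => t Dt; apply: cvg_EFin; last exact: cf.
  exact: nearW.
- exact: ig.
- by apply: aeW => t n Dt; rewrite /= lee_fin fg.
move=> h; apply: fine_cvg.
rewrite /Rintegral fineK; last exact: integrable_fin_num.
exact: h.
Qed.

Lemma rratio_ge0 M v : 0 <= v -> 0 <= rratio M v.
Proof.
move=> v0; rewrite exprn_ge0// mulr_ge0 ?expR_ge0//.
by rewrite addr_ge0// mulr_ge0// gscale_ge0.
Qed.

(** For M = 1, [rratio] is (1 + sqrt 2 v) exp(- sqrt 2 v), so a bound common to all M cannot be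
    Gaussian. The exponent 1/8 - v/4 lies above - v^2 / (2 (1 + 2 v)), because (v/4 - 1/8) (1 + 2 v)
    = v^2/2 - 1/8. *)
Definition rratio_bound v : R := expR (8^-1) * expR (- (4^-1 * v)).

Lemma rratio_bound_integrable : mu.-integrable `[0, +oo[ (EFin \o rratio_bound).
Proof.
have := integrable_exponential_pdf (rate := 4^-1 : R).
rewrite invr_gt0 ltr0n => /(_ isT) ie.
have : mu.-integrable `[0, +oo[ (fun t => (expR (8^-1) * 4)%:E * (exponential_pdf 4^-1
  t)%:E)%E.
  by apply: integrableZl => //; apply: integrableS ie.
apply: eq_integrable => // t; rewrite inE /= in_itv /= andbT => t0.
rewrite exponential_pdfE// /rratio_bound -EFinM mulNr; congr (_%:E).
by field.
Qed.

(** A sharpening of 1 + u <= exp u by the quadratic term u^2 / 4, without which the decay of (1 + x)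
    exp(-x) near 0 would be lost. *)
Lemma sqr_1D_expR (u : R) : -2 <= u -> (1 + u / 2) ^+ 2 <= expR u.
Proof.
move=> u2; have -> : expR u = expR (u / 2) ^+ 2.
  by rewrite -expRM_natl; congr expR; field.
by apply: lerXn2r; rewrite ?nnegrE ?expR_ge0 ?expR_ge1Dx//; lra.
Qed.

(** The exponent is quadratic near 0 and linear at infinity, like x - log(1 + x). For U = x - x^2 /
    (4 (1 + x)), the term U^2 / 4 of (1 + U/2)^2 repays what was subtracted from x, so 1 + x <= (1 +
    U/2)^2 <= exp U. *)
Lemma onemD_expR_le (x : R) : 0 <= x ->
  (1 + x) * expR (- x) <= expR (- (x ^+ 2 / (4 * (1 + x)))).
Proof.
move=> x0.
have x1 : 0 < 1 + x by lra.
have -> : - (x ^+ 2 / (4 * (1 + x))) = (x - x ^+ 2 / (4 * (1 + x))) - x by ring.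
rewrite [X in _ <= X]expRD ler_pM2r ?expR_gt0//.
have u0 : x - x ^+ 2 / (4 * (1 + x)) = x * (3 * x + 4) / (4 * (1 + x)).
  by field; rewrite gt_eqF.
have un : 0 <= x * (3 * x + 4) / (4 * (1 + x)).
  by apply: divr_ge0; [apply: mulr_ge0 => //; lra|lra].
apply: le_trans (sqr_1D_expR _); last by rewrite u0; lra.
rewrite u0 sqrrD expr1n mul1r.
set U := x * _ / _ in un u0 *.
have hU : x ^+ 2 <= U ^+ 2 * (1 + x).
  have -> : U ^+ 2 * (1 + x) = x ^+ 2 * (1 + x * (9 * x + 8) / (16 * (1 + x))).
    by rewrite /U; field; rewrite gt_eqF.
  rewrite ler_peMr ?exprn_ge0// lerDl.
  by apply: divr_ge0; [apply: mulr_ge0 => //; lra|lra].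
have : x ^+ 2 / (4 * (1 + x)) <= U ^+ 2 / 4.
  by rewrite ler_pdivrMr; [apply: le_trans hU _; lra|lra].
have -> : (U / 2) ^+ 2 = U ^+ 2 / 4 by field.
move: u0; set W := x ^+ 2 / _; set V := U ^+ 2 / 4 => u0 hW; lra.
Qed.

Lemma rratio_le_bound M v : (0 < M)%N -> 0 <= v -> rratio M v <= rratio_bound v.
Proof.
move=> M0 v0.
have g2 := @gscale_le2 R M M0; have gs := @gscale_sqr R M M0; have g0 := @gscale_ge0 R M.
have x0 : 0 <= gscale M * v by rewrite mulr_ge0.
have xv : gscale M * v <= 2 * v by rewrite ler_wpM2r.
rewrite /rratio.
have -> : (rratio_bound v : R) = expR (M%:R^-1 * (8^-1 - 4^-1 * v)) ^+ M.
  rewrite -expRM_natl mulrA divff ?mul1r ?expRD//.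
  by rewrite pnatr_eq0 -lt0n.
apply: lerXn2r; rewrite ?nnegrE ?expR_ge0 ?mulr_ge0 ?expR_ge0 ?addr_ge0//.
apply: le_trans (onemD_expR_le x0) _; rewrite ler_expR.
rewrite ler_pdivlMl ?ltr0n// mulrN mulrA exprMn mulrA gs.
rewrite lerNl opprB ler_pdivlMr; last by lra.
nra.
Qed.

(** For u = - (x + x^2 / 4) the quadratic terms of (1 + u/2)^2 cancel, leaving 1 - x + x^3 / 8 + x^4
    / 64. *)
Lemma onemB_expR_le (x : R) : 0 <= x <= 1 ->
  (1 - x) * expR x <= expR (- (x ^+ 2 / 4)).
Proof.
move=> /andP[x0 x1].
have -> : - (x ^+ 2 / 4) = - (x + x ^+ 2 / 4) + x by ring.
rewrite expRD ler_pM2r ?expR_gt0//.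
apply: le_trans (sqr_1D_expR _); nra.
Qed.

Lemma rratioN_ge0 M v : 0 <= gscale M * v <= 1 -> 0 <= rratio M (- v).
Proof.
move=> h; rewrite /rratio mulrN opprK exprn_ge0// mulr_ge0 ?expR_ge0//; lra.
Qed.

Lemma rratioN_le_bound M v : (0 < M)%N -> 0 <= gscale M * v <= 1 ->
  rratio M (- v) <= rratio_bound v.
Proof.
move=> M0 /[dup] h /andP[x0 x1].
have gs := @gscale_sqr R M M0.
rewrite /rratio mulrN opprK.
have -> : (rratio_bound v : R) = expR (M%:R^-1 * (8^-1 - 4^-1 * v)) ^+ M.
  rewrite -expRM_natl mulrA divff ?mul1r ?expRD//.
  by rewrite pnatr_eq0 -lt0n.
apply: lerXn2r; rewrite ?nnegrE ?expR_ge0 ?mulr_ge0 ?expR_ge0 ?subr_ge0//.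
apply: le_trans (onemB_expR_le h) _; rewrite ler_expR.
rewrite ler_pdivlMl ?ltr0n// mulrN mulrA exprMn mulrA gs.
have := sqr_ge0 (v - 4^-1); lra.
Qed.

Definition right_mass M : R := \int[mu]_(v in `[0, +oo[) rratio M v.
(** The cut-off v = 1 / [gscale M] is where the path leading left from M reaches 0. Extending by 0
    keeps the domain independent of M, as dominated convergence requires. *)
Definition left_mass M : R :=
  \int[mu]_(v in `[0, +oo[) if gscale M * v <= 1 then rratio M (- v) else 0.

Lemma cvg_right_mass : right_mass n.+1 @[n --> \oo] --> Num.sqrt pi / 2.
Proof.
have -> : Num.sqrt pi / 2 = \int[mu]_(v in `[0, +oo[) gauss_fun v :> R.
  by rewrite /Rintegral integral0y_gauss.
apply: (@Rintegral_dominated_convergence `[0, +oo[ (fun n => rratio n.+1) _ rratio_bound)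
  => //.
- move=> n; apply: measurable_funTS; apply: continuous_measurable_fun.
  exact: continuous_rratio.
- by apply: measurable_funTS; exact: measurable_gauss_fun.
- by move=> t _; exact: cvg_rratio.
- exact: rratio_bound_integrable.
- move=> n t /=; rewrite in_itv /= andbT => t0.
  by rewrite ger0_norm ?rratio_ge0 ?rratio_le_bound.
Qed.

Lemma cvg_left_mass : left_mass n.+1 @[n --> \oo] --> Num.sqrt pi / 2.
Proof.
have -> : Num.sqrt pi / 2 = \int[mu]_(v in `[0, +oo[) gauss_fun v :> R.
  by rewrite /Rintegral integral0y_gauss.
apply: (@Rintegral_dominated_convergence `[0, +oo[
   (fun n v => if gscale n.+1 * v <= 1 then rratio n.+1 (- v) else 0) _ rratio_bound) => //.
- move=> n; apply: measurable_funTS.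
  apply: measurable_fun_ifT => //.
    by apply: measurable_fun_ler.
  apply: continuous_measurable_fun => t; apply: continuous_comp;
    first exact: opp_continuous.
  exact: continuous_rratio.
- by apply: measurable_funTS; exact: measurable_gauss_fun.
- move=> t /=; rewrite in_itv /= andbT => t0.
  have hn : \forall n \near \oo, gscale n.+1 * t <= 1.
    have : gscale n.+1 * t @[n --> \oo] --> (0 * t : R).
      by apply: cvgM; [exact: cvg_gscale|exact: cvg_cst].
    by rewrite mul0r => /cvgr_le; apply; exact: ltr01.
  have := @cvg_rratio R (- t); rewrite /gauss_fun sqrrN; apply: cvg_trans.
  by apply: near_eq_cvg; near=> n; rewrite ifT//; near: n.
- exact: rratio_bound_integrable.
- move=> n t /=; rewrite in_itv /= andbT => t0.
  case: ifPn => h; last by rewrite normr0 mulr_ge0 ?expR_ge0.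
  have h2 : 0 <= gscale n.+1 * t <= 1 by rewrite h andbT mulr_ge0 ?gscale_ge0.
  by rewrite ger0_norm ?rratioN_ge0 ?rratioN_le_bound.
Unshelve. all: by end_near. Qed.

End gaussian_limits.

(** * Edge: Stirling's constant, the value at the centre, and erfc *)

Section edge_limit.
Variable R : realType.
Local Notation C := R[i].
Local Notation mu := (@lebesgue_measure R).
Implicit Types (z w x a d : C) (t v : R) (M : nat).

Lemma gconst_ge0 M : 0 <= gconst M :> R.
Proof. by rewrite !mulr_ge0 ?expR_ge0 ?gscale_ge0 ?exprn_ge0 ?invr_ge0. Qed.

Lemma derivable_continuous_at (f : R -> R) (t : R) (d : R) : is_derive t 1 f d ->
  continuous_at t f.
Proof.
by move=> h; apply: differentiable_continuous; apply/derivable1_diffP; case: h.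
Qed.

Lemma FTC2_is_derive (f F : R -> R) (a b : R) : a < b -> continuous f ->
  (forall t, is_derive t 1 F (f t)) -> \int[mu]_(t in `[a, b]) f t = F b - F a.
Proof.
move=> ab cf dF; rewrite /Rintegral (@continuous_FTC2 _ _ F)//.
- exact: continuous_subspaceT.
- have cF t : F x @[x --> t] --> F t by apply: derivable_continuous_at (dF t).
  split => [t _||]; first by case: (dF t).
    exact: cvg_at_right_filter.
  exact: cvg_at_left_filter.
- by move=> t _; rewrite derive1E; case: (dF t).
Qed.

Lemma continuous_integrable01 (f : R -> R) : continuous f ->
  mu.-integrable `[0, 1] (EFin \o f).
Proof.
move=> cf; apply: continuous_compact_integrable; first exact: segment_compact.
exact: continuous_subspaceT.
Qed.

Lemma rratio_integrable M : (0 < M)%N -> mu.-integrable `[0, +oo[ (EFin \o rratio M).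
Proof.
move=> M0; apply: le_integrable (@rratio_bound_integrable R) => //.
  apply/measurable_EFinP; apply: measurable_funTS; apply: continuous_measurable_fun.
  exact: continuous_rratio.
move=> t /=; rewrite in_itv /= andbT => t0.
by rewrite lee_fin !ger0_norm ?rratio_ge0 ?rratio_le_bound// mulr_ge0 ?expR_ge0.
Qed.

(** Integrating the derivative of [truncexp] from M to infinity, where the function vanishes. *)
Lemma gconst_right_mass M : (0 < M)%N ->
  gconst M * right_mass R M = Re (truncexp M.+1 (M%:R : C)).
Proof.
move=> M0; rewrite /right_mass -RintegralZl//; last exact: rratio_integrable.
pose F v := - Re (truncexp M.+1 (M%:R + (M%:R * gscale M)%:C * (v%:C * 1))).
have dF v : is_derive v 1 F (gconst M * rratio M v).
  have [h _] := cderiv_truncexp_path M 1 v.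
  rewrite /F; apply: is_derive_eq; rewrite ReN opprK mulr1 mulr1 gratio_real.
  by rewrite ReMr.
rewrite (@Rintegral_ge0_continuous_FTC2y _ _ F _ 0).
- by rewrite /F !mul0r mulr0 addr0 sub0r opprK.
- by move=> v v0; rewrite mulr_ge0 ?gconst_ge0 ?rratio_ge0.
- apply: continuous_subspaceT => v; apply: cvgM; first exact: cvg_cst.
  exact: continuous_rratio.
- rewrite -[X in _ --> X]oppr0; apply: cvgN.
  under eq_fun do rewrite mulr1 -rmorphM natc -rmorphD.
  apply: (@cvg_comp _ _ _ (fun v => M%:R + M%:R * gscale M * v)
    (fun t => Re (truncexp M.+1 t%:C))); last exact: cvg_truncexp_pinfty.
  apply: (@cvg_comp _ _ _ (fun v => M%:R * gscale M * v) (fun r => M%:R + r)).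
    by apply: gt0_cvgMry => //; rewrite mulr_gt0 ?gscale_gt0// ltr0n.
  exact: cvg_addrl.
- by move=> v _; case: (dF v).
- by apply: cvg_at_right_filter; apply: derivable_continuous_at (dF 0).
- by move=> v _; rewrite derive1E; case: (dF v).
Qed.

Lemma truncexp0 n : truncexp n.+1 (0 : C) = 1.
Proof.
rewrite /truncexp oppr0 cexp0 mul1r big_ord_recl big1 ?expr0 ?fact0 ?divr1 ?addr0//.
by move=> i _; rewrite /= /bump /= exprS !mul0r.
Qed.

(** Integrating the derivative of [truncexp] from 0, where its value is 1, to M. *)
Lemma gconst_left_mass M : (0 < M)%N ->
  gconst M * left_mass R M = 1 - Re (truncexp M.+1 (M%:R : C)).
Proof.
move=> M0; rewrite /left_mass.
have g0 : 0 < gscale M :> R by rewrite gscale_gt0.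
have -> : \int[mu]_(v in `[0, +oo[) (if gscale M * v <= 1 then rratio M (- v) else 0) =
    \int[mu]_(v in `[0, (gscale M)^-1]) rratio M (- v).
  rewrite (_ : `[0, (gscale M)^-1]%classic =
    `[0, +oo[%classic `&` [set v : R | gscale M * v <= 1]); last first.
    apply/seteqP; split => v /=; rewrite !in_itv /= andbT.
      by move=> /andP[v0 v1]; split=> //; rewrite mulrC -ler_pdivlMr// div1r.
    by move=> [-> h] /=; rewrite -div1r ler_pdivlMr// mulrC.
  rewrite Rintegral_mkcondr; apply: eq_Rintegral => v _; rewrite patchE.
  by rewrite mem_setE.
have cr : continuous (fun v => rratio M (- v)).
  move=> t; apply: continuous_comp; first exact: opp_continuous.
  exact: continuous_rratio.
rewrite -RintegralZl//; last first.
  apply: continuous_compact_integrable; first exact: segment_compact.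
  exact: continuous_subspaceT.
pose F v := Re (truncexp M.+1 (M%:R + (M%:R * gscale M)%:C * (v%:C * (-1)))).
have dF v : is_derive v 1 F (gconst M * rratio M (- v)).
  have [h _] := cderiv_truncexp_path M (-1) v.
  apply: is_derive_eq; rewrite mulrN1 opprK mulrN1 -rmorphN gratio_real.
  by rewrite ReMr.
rewrite (@FTC2_is_derive _ F)//.
- rewrite /F !mul0r mulr0 addr0 mulrN1 mulrN -rmorphM mulfK ?gt_eqF//.
  by rewrite rmorph_nat subrr truncexp0.
- by rewrite invr_gt0.
- by move=> t; apply: cvgM; [exact: cvg_cst|exact: cr].
Qed.

(** Stirling's formula, as [gconst M] = sqrt(2 M) M^M exp(-M) / M!. Adding the two mass identities
    eliminates the unknown value at M and shows that [gconst] is the inverse of the total mass,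
    which tends to sqrt pi. *)
Lemma cvg_gconst : gconst n.+1 @[n --> \oo] --> ((Num.sqrt pi)^-1 : R).
Proof.
have spi : Num.sqrt pi != 0 :> R by rewrite gt_eqF// sqrtr_gt0 pi_gt0.
have AB := cvgD (@cvg_right_mass R) (@cvg_left_mass R).
have -> : Num.sqrt pi = Num.sqrt pi / 2 + Num.sqrt pi / 2 :> R by field.
rewrite (_ : (fun n => gconst n.+1) = (fun n => (right_mass R n.+1 + left_mass R n.+1)^-1)).
  by apply: cvgV; [rewrite -splitr|exact: AB].
apply/funext => n.
have E : gconst n.+1 * (right_mass R n.+1 + left_mass R n.+1) = 1.
  by rewrite mulrDr gconst_right_mass// gconst_left_mass// addrC subrK.
have nz : right_mass R n.+1 + left_mass R n.+1 != 0.
  by apply/eqP => z; move: E; rewrite z mulr0 => /esym/eqP; rewrite oner_eq0.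
by apply: (mulIf nz); rewrite E mulVf.
Qed.

(** In probabilistic terms, a Poisson variable of mean M is at most M with probability tending to
    1/2. *)
Lemma cvg_truncexp_center :
  Re (truncexp n.+2 (n.+1%:R : C)) @[n --> \oo] --> (2^-1 : R).
Proof.
have spi : Num.sqrt pi != 0 :> R by rewrite gt_eqF// sqrtr_gt0 pi_gt0.
under eq_fun do rewrite -gconst_right_mass//.
have -> : 2^-1 = (Num.sqrt pi)^-1 * (Num.sqrt pi / 2) :> R by field.
by apply: cvgM; [exact: cvg_gconst|exact: cvg_right_mass].
Qed.

(** The shape of the integral in the definition of [cerfc], so that the limit at the edge can be
    folded into it. *)
Definition segment_integral (f : R -> C) : C :=
  (\int[mu]_(t in `[0, 1]) Re (f t)) +i* (\int[mu]_(t in `[0, 1]) Im (f t)).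

Lemma segment_integralZ k (f : R -> C) :
  continuous (fun t => Re (f t)) -> continuous (fun t => Im (f t)) ->
  segment_integral (fun t => k * f t) = k * segment_integral f.
Proof.
move=> cR cI.
have iZ (g : R -> R) r : continuous g ->
    mu.-integrable `[0, 1] (EFin \o (fun t => r * g t)).
  move=> cg; apply: continuous_integrable01 => t.
  by apply: cvgM; [exact: cvg_cst|exact: cg].
have iR := continuous_integrable01 cR; have iI := continuous_integrable01 cI.
apply: complex_ext; rewrite (ReM, ImM) /=.
  under eq_Rintegral do rewrite ReM.
  by rewrite RintegralB ?RintegralZl//; exact: iZ.
under eq_Rintegral do rewrite ImM.
by rewrite RintegralD ?RintegralZl//; exact: iZ.
Qed.

Lemma segment_integral_FTC (f F : R -> C) :
  continuous (fun t => Re (f t)) -> continuous (fun t => Im (f t)) ->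
  (forall t, cderiv F t (f t)) -> segment_integral f = F 1 - F 0.
Proof.
move=> cR cI dF; apply: complex_ext; rewrite (ReD, ImD) (ReN, ImN) /=.
  by apply: (FTC2_is_derive (F := fun t => Re (F t)) ltr01 cR) => t; case: (dF t).
by apply: (FTC2_is_derive (F := fun t => Im (F t)) ltr01 cI) => t; case: (dF t).
Qed.

Lemma truncexp_path M a :
  truncexp M.+1 (M%:R + (M%:R * gscale M)%:C * a) =
  truncexp M.+1 M%:R -
  (gconst M)%:C * (a * segment_integral (fun t => gratio M (t%:C * a))).
Proof.
have [cR cI] := continuous_gratio M a.
have cZ k : continuous (fun t => Re (k * gratio M (t%:C * a))) /\
            continuous (fun t => Im (k * gratio M (t%:C * a))).
  split => t.
    under eq_fun do rewrite ReM;
    by apply: cvgB; apply: cvgM; [exact: cvg_cst|exact: cR|exact: cvg_cst|exact: cI].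
  under eq_fun do rewrite ImM;
  by apply: cvgD; apply: cvgM; [exact: cvg_cst|exact: cI|exact: cvg_cst|exact: cR].
pose k := - ((gconst M)%:C * a).
have [kR kI] := cZ k.
have := segment_integral_FTC kR kI (F := fun t => truncexp M.+1 (M%:R + (M%:R * gscale
  M)%:C * (t%:C * a))).
rewrite mul1r mul0r mulr0 addr0 segment_integralZ// => h.
have /h/eqP : forall t, cderiv (fun t0 => truncexp M.+1 (M%:R + (M%:R * gscale M)%:C *
    (t0%:C * a))) t (k * gratio M (t%:C * a)).
  by move=> t; apply: cderiv_eq (cderiv_truncexp_path M a t) _; rewrite /k; ring.
by rewrite eq_sym subr_eq => /eqP ->; rewrite /k addrC mulNr mulrA.
Qed.

(** The convergent endpoints are bounded by some B, so [normc_gratio] dominates all integrands on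
    [0, 1] by the constant exp(B^2). *)
Lemma ccvg_segment_integral_gratio (a_ : nat -> C) a : ccvg a_ a ->
  ccvg (fun n => segment_integral (fun t => gratio n.+1 (t%:C * a_ n)))
       (segment_integral (fun t => cexp (- (t%:C * a) ^+ 2))).
Proof.
move=> aa.
have [B aB] : exists B, forall n, normc (a_ n) <= B.
  have /cvgP/cvg_seq_bounded := ccvg_normc aa.
  case=> B [_ /(_ (B + 1))]; rewrite ltrDl ltr01 => /(_ isT) h.
  by exists (B + 1) => n; have := h n I; rewrite /= ger0_norm ?normc_ge0.
have gB n t : `[0, 1]%classic t -> normc (gratio n.+1 (t%:C * a_ n)) <= expR (B ^+ 2).
  rewrite /= in_itv /= => /andP[t0 t1].
  apply: le_trans (normc_gratio _ _) _ => //.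
  rewrite ler_expR Normc.normcM normc_real ger0_norm//.
  have n0 := normc_ge0 (a_ n); have B0 : 0 <= B by exact: le_trans (aB n).
  apply: lerXn2r; rewrite ?nnegrE ?mulr_ge0//.
  by apply: le_trans (aB n); rewrite ler_piMl.
have cg t : ccvg (fun n => gratio n.+1 (t%:C * a_ n)) (cexp (- (t%:C * a) ^+ 2)).
  by apply: ccvg_gratio; apply: ccvgM => //; exact: ccvg_cst.
have dG t : exists d, cderiv (fun t => cexp (- (t%:C * a) ^+ 2)) t d.
  eexists; apply: cderiv_cexp; apply: cderivN; apply: cderivX.
  exact: cderivM (cderiv_id _) (cderiv_cst _ _).
have iB : mu.-integrable `[0, 1] (EFin \o cst (expR (B ^+ 2))).
  by apply: continuous_integrable01; exact: cst_continuous.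
have mc (f : R -> R) : continuous f -> measurable_fun (`[0, 1]%classic : set
  (measurableTypeR R)) f.
  by move=> cf; apply: measurable_funTS; exact: continuous_measurable_fun.
split; apply: (@Rintegral_dominated_convergence _ _ _ _ (cst (expR (B ^+ 2)))) => //.
- by move=> n; apply: mc; have [] := continuous_gratio n.+1 (a_ n).
- by apply: mc => t; have [d /cderiv_continuous[]] := dG t.
- by move=> t _; have [] := cg t.
- by move=> n t /(gB n); apply: le_trans; exact: normc_Re.
- by move=> n; apply: mc; have [] := continuous_gratio n.+1 (a_ n).
- by apply: mc => t; have [d /cderiv_continuous[]] := dG t.
- by move=> t _; have [] := cg t.
- by move=> n t /(gB n); apply: le_trans; exact: normc_Im.
Qed.

Lemma ccvg_truncexp_edge (a_ : nat -> C) a : ccvg a_ a ->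
  ccvg (fun n => truncexp n.+2 (n.+1%:R + (n.+1%:R * gscale n.+1)%:C * a_ n))
       (2^-1 * cerfc a).
Proof.
move=> aa.
have -> : 2^-1 * cerfc a = (2^-1)%:C - ((Num.sqrt pi)^-1)%:C *
    (a * segment_integral (fun t => cexp (- (t%:C * a) ^+ 2))).
  rewrite /cerfc -/(segment_integral _) mulrBr mulr1 !(rmorphM, fmorphV) rmorph_nat.
  by congr (_ - _); rewrite !mulrA mulVf ?mul1r// pnatr_eq0.
apply: eq_ccvg (ccvgB (ccvg_real cvg_truncexp_center) (ccvgM (ccvg_real cvg_gconst)
  (ccvgM aa (ccvg_segment_integral_gratio aa)))).
move=> n /=; rewrite truncexp_path; congr (_ - _).
by rewrite natc truncexp_real.
Qed.

End edge_limit.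

(** * Bulk: the Chernoff bound *)

Section bulk_limit.
Variable R : realType.
Local Notation C := R[i].
Implicit Types (z w x a d : C) (t v : R) (M : nat).

Lemma expR_ge_Xn_fact (x : R) n : 0 <= x -> x ^+ n / n`!%:R <= expR x.
Proof.
move=> x0; case: n => [|n]; first by rewrite expr0 fact0 divr1 -[X in X <= _]expR0 ler_expR.
by apply: le_trans (expR_ge1Dxn n x0); rewrite lerDr.
Qed.

(** Along t z put y = t |z|. Closeness of z to the positive axis gives |exp(-t z)| <= exp(c - y).
    Bounding (y / rho)^M / M! by exp(y / rho) leaves exp(y (1 / rho - 1)), at most exp((M + 1) (1 -
    rho)) because y <= rho (M + 1). The division by rho in the constant completes rho^M to
    rho^(M+1). *)
Lemma truncexp_sub1_le M z (rho c : R) : 0 < rho <= 1 -> 0 <= c ->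
  normc z <= Re z + c -> normc z <= rho * M.+1%:R ->
  normc (truncexp M.+1 z - 1) <=
  2 * (expR c / rho) * (M.+1%:R * (rho * expR (1 - rho)) ^+ M.+1).
Proof.
move=> /andP[rho0 rho1] c0 zc zM.
pose f t := truncexp M.+1 (t%:C * z).
pose f' t := - (cexp (- (t%:C * z)) * ((t%:C * z) ^+ M / M`!%:R) * z).
have df t : cderiv f t (f' t).
  apply: cderiv_eq (cderiv_truncexp M (cderivM (cderiv_id t) (cderiv_cst z t))) _.
  by rewrite /f' /=; ring.
have := @complex_mean_value R f f'
  (expR c / rho * (M.+1%:R * (rho * expR (1 - rho)) ^+ M.+1)) df.
rewrite /f mul1r mul0r truncexp0 -[2 * _ * _]mulrA; apply => t /andP[t0 t1].
have z0 := normc_ge0 z.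
have y0 : 0 <= t * normc z by rewrite mulr_ge0.
have yz : t * normc z <= rho * M.+1%:R.
  by apply: le_trans zM; rewrite ler_piMl.
rewrite /f' normcN Normc.normcM Normc.normcM normc_cexp Normc.normcM normcX Normc.normcM.
rewrite Normc.normcV normc_real (ger0_norm t0) natc normc_real ger0_norm// ReN ReMr.
have e1 : expR (- (t * Re z)) <= expR c * expR (- (t * normc z)).
  rewrite -expRD ler_expR; nra.
have e2 : (t * normc z) ^+ M / M`!%:R <= rho ^+ M * expR (t * normc z / rho).
  have := expR_ge_Xn_fact M (divr_ge0 y0 (ltW rho0)).
  rewrite expr_div_n mulrAC ler_pdivrMr ?exprn_gt0//.
  by rewrite [X in _ <= X -> _]mulrC.
have e3 : expR (- (t * normc z)) * expR (t * normc z / rho) <=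
    expR (1 - rho) ^+ M.+1.
  rewrite -expRD -expRM_natl ler_expR.
  have -> : - (t * normc z) + t * normc z / rho = t * normc z * ((1 - rho) / rho).
    by field; rewrite gt_eqF.
  have -> : M.+1%:R * (1 - rho) = (rho * M.+1%:R) * ((1 - rho) / rho).
    by field; rewrite gt_eqF.
  by rewrite ler_wpM2r// divr_ge0 ?subr_ge0// ltW.
have zM' : normc z <= M.+1%:R.
  by apply: le_trans zM _; rewrite ler_piMl.
have -> : expR c / rho * (M.+1%:R * (rho * expR (1 - rho)) ^+ M.+1) =
    expR c * rho ^+ M * expR (1 - rho) ^+ M.+1 * M.+1%:R.
  by rewrite exprMn (exprS rho); field; rewrite gt_eqF.
apply: ler_pM; rewrite ?mulr_ge0 ?expR_ge0 ?exprn_ge0 ?invr_ge0//.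
apply: le_trans (ler_pM (expR_ge0 _) _ e1 e2) _; first by rewrite divr_ge0 ?exprn_ge0.
rewrite -2!(mulrA (expR c)) ler_wpM2l ?expR_ge0// mulrCA.
by apply: ler_wpM2l e3; rewrite exprn_ge0// ltW.
Qed.

(** For q = exp k with k < 0, exp(-n k) >= (n k)^2 / 2 gives n q^n <= 2 / (k^2 n). *)
Lemma cvg_nat_geometric (q : R) : 0 < q < 1 -> n.+1%:R * q ^+ n.+1 @[n --> \oo] --> (0 : R).
Proof.
move=> /andP[q0 q1]; have [k kq] := expR_total q0.
have k0 : 0 < - k by rewrite oppr_gt0 -expR_lt1 kq.
apply: (@squeeze_cvgr _ _ _ _ (cst 0) (fun n => 2 / k ^+ 2 * harmonic n)).
- apply: nearW => n; rewrite mulr_ge0 ?exprn_ge0 ?(ltW q0)//=.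
  have nk : 0 <= n.+1%:R * - k by rewrite mulr_ge0 ?(ltW k0).
  have := expR_ge_Xn_fact 2 nk.
  rewrite -kq -expRM_natl -[n.+1%:R * k]opprK expRN -mulrN => h.
  rewrite ler_pdivrMr ?expR_gt0//.
  have c0 : 0 <= 2 / k ^+ 2 / n.+1%:R by rewrite !divr_ge0 ?sqr_ge0.
  apply: le_trans (ler_wpM2l c0 h).
  rewrite le_eqVlt; apply/orP; left; apply/eqP; rewrite (_ : 2`! = 2)%N//; field.
  by rewrite nat1r pnatr_eq0 /= -oppr_eq0 gt_eqF.
- exact: cvg_cst.
- rewrite -[X in _ --> X](mulr0 (2 / k ^+ 2)); apply: cvgM; first exact: cvg_cst.
  exact: cvg_harmonic.
Qed.

Lemma ccvg_truncexp_bulk (z_ : nat -> C) (rho c : R) : 0 < rho < 1 -> 0 <= c ->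
  (forall n, normc (z_ n) <= Re (z_ n) + c) ->
  (\forall n \near \oo, normc (z_ n) <= rho * n.+1%:R) ->
  ccvg (fun n => truncexp n.+1 (z_ n)) 1.
Proof.
move=> /andP[rho0 rho1] c0 zc zM; apply: normc_ccvg.
apply: (@squeeze_cvgr _ _ _ _ (cst 0)
  (fun n => 2 * (expR c / rho) * (n.+1%:R * (rho * expR (1 - rho)) ^+ n.+1))).
- near=> n; rewrite normc_ge0 truncexp_sub1_le ?rho0 ?(ltW rho1)//.
  by near: n.
- exact: cvg_cst.
- rewrite -[X in _ --> X](mulr0 (2 * (expR c / rho))); apply: cvgM; first exact: cvg_cst.
  apply: cvg_nat_geometric; rewrite mulr_gt0 ?expR_gt0//=.
  (* The ratio rho exp(1 - rho) is below 1 by the strict inequality 1 + y < exp y at y = rho - 1. *)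
  have -> : 1 - rho = - (rho - 1) by rewrite opprB.
  rewrite expRN ltr_pdivrMr ?expR_gt0// mul1r.
  have := @expR_gt1Dx R (rho - 1); rewrite addrCA subrr addr0; apply.
  by rewrite subr_eq0 lt_eqF.
Unshelve. all: by end_near. Qed.

End bulk_limit.

(** * Measurability and integration of complex-valued functions *)

Section complex_integration.
Context d (T : measurableType d) (R : realType).
Local Notation C := R[i].
Implicit Types (f g : T -> C) (c k v w : C).

Definition cmeasurable f :=
  measurable_fun setT (fun x => Re (f x)) /\ measurable_fun setT (fun x => Im (f x)).

Lemma cmeasurable_cst c : cmeasurable (fun=> c).
Proof. by split; exact: measurable_cst. Qed.

Lemma cmeasurable_real (f : T -> R) : measurable_fun setT f ->
  cmeasurable (fun x => (f x)%:C).
Proof. by move=> mf; split=> //=; exact: measurable_cst. Qed.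

Lemma cmeasurableD f g : cmeasurable f -> cmeasurable g -> cmeasurable (fun x => f x + g x).
Proof.
move=> [f1 f2] [g1 g2]; split.
  by under eq_fun do rewrite ReD; exact: measurable_funD.
by under eq_fun do rewrite ImD; exact: measurable_funD.
Qed.

Lemma cmeasurableM f g : cmeasurable f -> cmeasurable g -> cmeasurable (fun x => f x * g x).
Proof.
move=> [f1 f2] [g1 g2]; split.
  by under eq_fun do rewrite ReM; apply: measurable_funB; exact: measurable_funM.
by under eq_fun do rewrite ImM; apply: measurable_funD; exact: measurable_funM.
Qed.

Lemma cmeasurableX f n : cmeasurable f -> cmeasurable (fun x => f x ^+ n).
Proof.
move=> mf; elim: n => [|n IH].
  by under eq_fun do rewrite expr0; exact: cmeasurable_cst.
by under eq_fun do rewrite exprS; exact: cmeasurableM.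
Qed.

Lemma cmeasurable_sum I (r : seq I) (F : I -> T -> C) :
  (forall i, cmeasurable (F i)) -> cmeasurable (fun x => \sum_(i <- r) F i x).
Proof.
move=> h; elim: r => [|i r IH].
  by under eq_fun do rewrite big_nil; exact: cmeasurable_cst.
by under eq_fun do rewrite big_cons; exact: cmeasurableD.
Qed.

Lemma cmeasurable_prod I (r : seq I) (F : I -> T -> C) :
  (forall i, cmeasurable (F i)) -> cmeasurable (fun x => \prod_(i <- r) F i x).
Proof.
move=> h; elim: r => [|i r IH].
  by under eq_fun do rewrite big_nil; exact: cmeasurable_cst.
by under eq_fun do rewrite big_cons; exact: cmeasurableM.
Qed.

Lemma cmeasurable_det m (A : T -> 'M[C]_m) :
  (forall i j, cmeasurable (fun x => A x i j)) -> cmeasurable (fun x => \det (A x)).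
Proof.
move=> h; apply: cmeasurable_sum => s; apply: cmeasurableM; first exact: cmeasurable_cst.
by apply: cmeasurable_prod => i; exact: h.
Qed.

Lemma cmeasurableJ f : cmeasurable f -> cmeasurable (fun x => conjc (f x)).
Proof.
move=> [f1 f2]; split.
  by under eq_fun do rewrite ReJ.
by under eq_fun do rewrite ImJ; exact: measurableT_comp.
Qed.

Lemma cmeasurable_cexp f : cmeasurable f -> cmeasurable (fun x => cexp (f x)).
Proof.
move=> [f1 f2]; apply: cmeasurableM.
  apply: cmeasurable_real; apply: measurableT_comp => //.
split=> /=.
  apply: measurableT_comp => //; apply: continuous_measurable_fun; exact: continuous_cos.
apply: measurableT_comp => //; apply: continuous_measurable_fun; exact: continuous_sin.
Qed.

Lemma measurable_normc_sqr f : cmeasurable f ->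
  measurable_fun setT (fun x => normc (f x) ^+ 2).
Proof.
move=> [f1 f2]; under eq_fun do rewrite normc_sqr.
by apply: measurable_funD; exact: measurable_funX.
Qed.

Variable mu : {measure set T -> \bar R}.

Definition cintegrable f :=
  forall c, mu.-integrable setT (EFin \o (fun x => Re (c * f x))).

Lemma cintegrableD f g : cintegrable f -> cintegrable g -> cintegrable (fun x => f x + g x).
Proof.
move=> hf hg c; rewrite (_ : _ \o _ = (fun x => (Re (c * f x))%:E + (Re (c * g x))%:E)%E).
  by apply: integrableD => //; [exact: hf|exact: hg].
by apply/funext => x /=; rewrite (mulrDr c) ReD.
Qed.

Lemma cintegrableZ k f : cintegrable f -> cintegrable (fun x => k * f x).
Proof. by move=> hf c; under eq_fun do rewrite mulrA; exact: hf. Qed.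

Lemma cintegrable_le f (g : T -> R) : cmeasurable f -> mu.-integrable setT (EFin \o g) ->
  (forall x, normc (f x) <= g x) -> cintegrable f.
Proof.
move=> mf ig fg c.
apply: (@le_integrable _ _ _ _ _ _ _ (fun x => (normc c)%:E * (g x)%:E)%E) => //.
- apply/measurable_EFinP.
  by have [] := cmeasurableM (cmeasurable_cst c) mf.
- move=> x _; rewrite /= lee_fin; apply: le_trans (normc_Re _) _.
  rewrite Normc.normcM (@ger0_norm _ (_ * _)).
    by rewrite ler_wpM2l ?normc_ge0.
  by rewrite mulr_ge0 ?normc_ge0//; apply: le_trans (fg x); exact: normc_ge0.
- by apply: integrableZl.
Qed.

(** Testing against all functionals Re (c f) makes complex linearity immediate, since a scalar is
    absorbed into c, and bundles integrability with the value. The choices c = 1 and c = i recover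
    the two components. *)
Definition cint f v := forall c,
  mu.-integrable setT (EFin \o (fun x => Re (c * f x))) /\
  \int[mu]_(x in setT) Re (c * f x) = Re (c * v).

Lemma cintegrable_cint f : cintegrable f -> exists v, cint f v.
Proof.
move=> hf; exists ((\int[mu]_(x in setT) Re (1 * f x)) -i* (\int[mu]_(x in setT) Re ('i%C
  * f x))).
move=> c; split; first exact: hf.
have h1 := hf 1; have hi := hf 'i%C.
rewrite ReM /= mulrN opprK -!RintegralZl// -RintegralD//.
- by apply: eq_Rintegral => x _; rewrite !ReM /=; ring.
- by rewrite (_ : _ \o _ = fun x => ((Re c)%:E * (Re (1 * f x))%:E)%E)//;
  exact: integrableZl.
- by rewrite (_ : _ \o _ = fun x => ((Im c)%:E * (Re ('i%C * f x))%:E)%E)//;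
  exact: integrableZl.
Qed.

Lemma cint_uniq f v w : cint f v -> cint f w -> v = w.
Proof.
move=> hv hw; apply: complex_ext.
  by have [_] := hv 1; have [_ ->] := hw 1; rewrite !mul1r => ->.
have [_] := hv 'i%C; have [_ ->] := hw 'i%C; rewrite !ReM /= !mul0r !sub0r !mul1r.
by move/oppr_inj => ->.
Qed.

Lemma eq_cint f g v : f =1 g -> cint f v -> cint g v.
Proof. by move=> /funext ->. Qed.

Lemma cint0 : cint (fun=> 0) 0.
Proof.
move=> c; rewrite mulr0; split; first exact: integrable0.
by rewrite Rintegral_cst ?mul0r.
Qed.

Lemma cintD f g v w : cint f v -> cint g w -> cint (fun x => f x + g x) (v + w).
Proof.
move=> hf hg c; have [f1 f2] := hf c; have [g1 g2] := hg c; split.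
  by apply: cintegrableD => k; [have [] := hf k|have [] := hg k].
by under eq_Rintegral do rewrite mulrDr ReD; rewrite RintegralD// f2 g2 mulrDr ReD.
Qed.

Lemma cintZ k f v : cint f v -> cint (fun x => k * f x) (k * v).
Proof. by move=> hf c; under eq_fun do rewrite mulrA; rewrite mulrA; exact: hf. Qed.

Lemma cint_sum I (r : seq I) (F : I -> T -> C) (V : I -> C) :
  (forall i, cint (F i) (V i)) ->
  cint (fun x => \sum_(i <- r) F i x) (\sum_(i <- r) V i).
Proof.
move=> h; elim: r => [|i r IH].
  by rewrite big_nil; under eq_fun do rewrite big_nil; exact: cint0.
by rewrite big_cons; under eq_fun do rewrite big_cons; exact: cintD.
Qed.

End complex_integration.

(** * Moments of the planar Gaussian weight *)

Section gaussian_moments.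
Variable R : realType.
Local Notation C := R[i].
Local Notation mu := (@lebesgue_measure R).
Local Notation plane := (measurableTypeR R * measurableTypeR R)%type.
Local Notation nu := (@plane_lebesgue R).
Implicit Types (z w c : C).

Definition point (p : plane) : C := p.1 +i* p.2.

Lemma Rintegral_derive_setT (f F : R -> R) : continuous f ->
  (forall t : R, is_derive t 1 F (f t)) -> mu.-integrable setT (EFin \o f) ->
  F n%:R @[n --> \oo] --> (0 : R) -> F (- n%:R) @[n --> \oo] --> (0 : R) ->
  \int[mu]_(t in setT) f t = 0.
Proof.
move=> cf dF If Fp Fm.
pose S n : set (measurableTypeR R) := `[- n.+1%:R, n.+1%:R]%classic.
have mf : measurable_fun (setT : set (measurableTypeR R)) f by exact:
  continuous_measurable_fun.
have h : \int[mu]_(t in setT) (f \_ (S n)) t @[n --> \oo] --> \int[mu]_(t in setT) f t.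
  apply: (@Rintegral_dominated_convergence _ _ _ _ (fun t => `|f t|)) => //.
  - move=> n; apply/measurable_restrict => //.
      by rewrite /S.
    by apply: measurable_funTS.
  - move=> t _; apply: cvg_near_cst; near=> n; rewrite patchE ifT// inE /S /= in_itv /=.
    rewrite -ler_norml; near: n.
    apply: filterS (nbhs_infty_ger `|t|) => n /le_trans; apply.
    by rewrite ler_nat.
  - by have := integrable_norm If.
  - move=> n t _; rewrite patchE; case: ifP => // _.
    by rewrite normr0.
have h2 : \int[mu]_(t in setT) (f \_ (S n)) t @[n --> \oo] --> (0 : R).
  rewrite [X in X @ _ --> _](_ : _ = fun n => F n.+1%:R - F (- n.+1%:R)); last first.
    apply/funext => n; rewrite -Rintegral_mkcond /S FTC2_is_derive//.
    by rewrite gtrN.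
  rewrite -[X in _ --> X](subr0 0); apply: cvgB.
    by have := Fp; rewrite -(cvg_shiftS (fun n => F n%:R)).
  by have := Fm; rewrite -(cvg_shiftS (fun n => F (- n%:R))).
exact: cvg_unique h h2.
Unshelve. all: by end_near. Qed.

(** The weight exp(-x^2) is split into two equal factors: one absorbs the polynomial part of a
    moment, the other remains as an integrable bound. *)
Definition halfgauss (x : R) : R := expR (- (x ^+ 2 / 2)).

Lemma halfgauss_ge0 x : 0 <= halfgauss x. Proof. exact: expR_ge0. Qed.

Lemma halfgauss_le1 x : halfgauss x <= 1.
Proof. by rewrite expR_le1 oppr_le0 divr_ge0 ?sqr_ge0. Qed.

Lemma measurable_halfgauss : measurable_fun setT halfgauss.
Proof.
apply: measurableT_comp => //; apply: measurableT_comp => //.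
by apply: measurable_funM => //; exact: measurable_funX.
Qed.

Lemma halfgauss_integrable : mu.-integrable setT (EFin \o halfgauss).
Proof.
have i1 := @integrable_normal_pdf R 0 1.
have := integrableZl measurableT (normal_peak (1 : R))^-1 i1.
apply: eq_integrable => // x _; rewrite /= normal_pdfE ?oner_neq0//.
rewrite -EFinM mulrA mulVf ?mul1r; last by rewrite gt_eqF// normal_peak_gt0 ?oner_neq0.
by rewrite /normal_fun subr0 expr1n /halfgauss mulNr.
Qed.

Lemma cvg_halfgauss : halfgauss n%:R @[n --> \oo] --> (0 : R).
Proof.
apply: (@squeeze_cvgr _ _ _ _ (cst 0) (fun n => expR 2^-1 * expR (- n%:R))).
- apply: nearW => n; rewrite halfgauss_ge0 /= -expRD ler_expR.
  by have := sqr_ge0 (n%:R - 1 : R); rewrite sqrrB1; lra.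
- exact: cvg_cst.
- rewrite -[X in _ --> X](mulr0 (expR 2^-1)); apply: cvgM; first exact: cvg_cst.
  exact: cvgn_expR.
Qed.

Lemma integral_plane_prod (f g : R -> R) (a b : R) :
  measurable_fun (setT : set (measurableTypeR R)) f ->
  measurable_fun (setT : set (measurableTypeR R)) g ->
  (forall x, 0 <= f x) -> (forall x, 0 <= g x) ->
  (\int[mu]_x (f x)%:E = a%:E)%E -> (\int[mu]_x (g x)%:E = b%:E)%E ->
  (\int[nu]_p (f p.1 * g p.2)%:E = (a * b)%:E)%E.
Proof.
move=> mf mg f0 g0 fa gb.
have m12 : measurable_fun setT (fun p : plane => (f p.1 * g p.2)%:E).
  by apply/measurable_EFinP; apply: measurable_funM; exact: measurableT_comp.
rewrite /plane_lebesgue fubini_tonelli1//; last by move=> p; rewrite lee_fin mulr_ge0.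
rewrite /fubini_F /=.
under eq_integral => x _.
  under eq_integral do rewrite EFinM.
  rewrite ge0_integralZl//; last first.
  - by rewrite lee_fin.
  - by move=> y _; rewrite lee_fin.
  - exact/measurable_EFinP.
  rewrite gb muleC.
  over.
rewrite ge0_integralZl//.
- by rewrite fa muleC -EFinM.
- exact/measurable_EFinP.
- by move=> y _; rewrite lee_fin.
- by rewrite -gb; apply: integral_ge0 => y _; rewrite lee_fin.
Qed.

Lemma halfgauss_prod_integrable :
  nu.-integrable setT (EFin \o (fun p : plane => halfgauss p.1 * halfgauss p.2)).
Proof.
have mh := measurable_halfgauss; have h0 := halfgauss_ge0.
have [a ia] : exists a : R, (\int[mu]_x (halfgauss x)%:E = a%:E)%E.
  exists (fine (\int[mu]_x (halfgauss x)%:E)); rewrite fineK//.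
  exact: integrable_fin_num halfgauss_integrable.
apply/integrableP; split.
  by apply/measurable_EFinP; apply: measurable_funM; exact: measurableT_comp.
under eq_integral => p _ do rewrite /= ger0_norm ?mulr_ge0//.
by rewrite (integral_plane_prod mh mh h0 h0 ia ia) ltry.
Qed.

Definition moment j k z : C := z ^+ j * conjc z ^+ k * cexp (- (z * conjc z)).

Lemma normc_moment j k z :
  normc (moment j k z) = normc z ^+ (j + k) * expR (- normc z ^+ 2).
Proof.
rewrite /moment Normc.normcM Normc.normcM !normcX normcJ_eq -exprD normc_cexp.
by rewrite ReN mulcJ.
Qed.

Definition moment_bound n : R := 1 + 2 ^+ n * n`!%:R.

(** The series of exp(t^2 / 2) gives t^(2n) <= 2^n n! exp(t^2 / 2), and t^n <= 1 + t^(2n). *)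
Lemma Xn_expRN_sqr_le n (t : R) : 0 <= t ->
  t ^+ n * expR (- t ^+ 2) <= moment_bound n * halfgauss t.
Proof.
move=> t0; have -> : - t ^+ 2 = - (t ^+ 2 / 2) + - (t ^+ 2 / 2) by field.
rewrite expRD -/(halfgauss t) mulrA ler_wpM2r ?halfgauss_ge0//.
rewrite /halfgauss expRN ler_pdivrMr ?expR_gt0//.
set E := expR _; have t20 : 0 <= t ^+ 2 / 2 by rewrite divr_ge0 ?exprn_ge0.
have E1 : 1 <= E by rewrite -[X in X <= _]expR0 ler_expR.
have En : t ^+ n * t ^+ n <= 2 ^+ n * n`!%:R * E.
  have := expR_ge_Xn_fact n t20; rewrite expr_div_n mulrAC.
  rewrite !ler_pdivrMr ?exprn_gt0 ?ltr0n ?fact_gt0// -exprM mulnC exprM expr2.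
  by rewrite -/E -mulrA [E * _]mulrC.
rewrite /moment_bound mulrDl mul1r.
have tn := exprn_ge0 n t0.
by nra.
Qed.

Lemma halfgauss_normc z : halfgauss (normc z) = halfgauss (Re z) * halfgauss (Im z).
Proof. by rewrite /halfgauss -expRD normc_sqr mulrDl opprD. Qed.

Lemma moment_bound_ge0 n : 0 <= moment_bound n.
Proof. by rewrite addr_ge0 ?mulr_ge0 ?exprn_ge0. Qed.

Lemma normc_moment_le j k z :
  normc (moment j k z) <= moment_bound (j + k) * (halfgauss (Re z) * halfgauss (Im z)).
Proof. by rewrite normc_moment -halfgauss_normc Xn_expRN_sqr_le ?normc_ge0. Qed.

Lemma cmeasurable_moment d (T : measurableType d) (f : T -> C) j k :
  cmeasurable f -> cmeasurable (fun x => moment j k (f x)).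
Proof.
move=> mf; have mfJ := cmeasurableJ mf.
apply: cmeasurableM; first by apply: cmeasurableM; exact: cmeasurableX.
apply: cmeasurable_cexp.
under eq_fun do rewrite -mulN1r.
by apply: cmeasurableM; [exact: cmeasurable_cst|exact: cmeasurableM].
Qed.

Lemma cmeasurable_point : cmeasurable point.
Proof. by split=> /=; [exact: measurable_fst|exact: measurable_snd]. Qed.

Lemma moment_cintegrable j k : cintegrable nu (fun p => moment j k (point p)).
Proof.
apply: (@cintegrable_le _ _ _ nu _ (fun p : plane => moment_bound (j + k) * (halfgauss
  p.1 * halfgauss p.2))).
- exact: cmeasurable_moment cmeasurable_point.
- have := integrableZl measurableT (moment_bound (j + k)) halfgauss_prod_integrable.
  by apply: eq_integrable.
- by move=> p; exact: normc_moment_le.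
Qed.

(** By [halfgauss_normc], the hypothesis on [l] says that |l x| >= |x|. *)
Lemma moment_slice_cintegrable (l : R -> C) j k : cmeasurable l ->
  (forall x, halfgauss (Re (l x)) * halfgauss (Im (l x)) <= halfgauss x) ->
  cintegrable mu (fun x => moment j k (l x)).
Proof.
move=> ml lb.
apply: (@cintegrable_le _ _ _ mu _ (fun x : measurableTypeR R => moment_bound (j + k) *
  halfgauss x)).
- exact: cmeasurable_moment.
- have := integrableZl measurableT (moment_bound (j + k)) halfgauss_integrable.
  by apply: eq_integrable.
- move=> x; apply: le_trans (normc_moment_le _ _ _) _.
  by rewrite ler_wpM2l ?moment_bound_ge0.
Qed.

(** The derivative of [moment j k] in the direction a, that is, a d/dz + conj(a) d/dconj(z). A
    truncated predecessor occurs only with coefficient 0. *)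
Definition dmoment j k a z : C :=
  j%:R * a * moment j.-1 k z + k%:R * conjc a * moment j k.-1 z
  - conjc a * moment j.+1 k z - a * moment j k.+1 z.

Lemma cderiv_moment j k a b t :
  cderiv (fun t => moment j k (b + t%:C * a)) t (dmoment j k a (b + t%:C * a)).
Proof.
have dz := cderivD (cderiv_cst b t) (cderivM (cderiv_id t) (cderiv_cst a t)).
have dJ : cderiv (fun t => conjc (b + t%:C * a)) t (conjc a).
  have cE s : conjc (b + s%:C * a) = conjc b + s%:C * conjc a.
    by rewrite rmorphD rmorphM; congr (_ + _ * _); exact: conjc_real.
  under eq_fun do rewrite cE.
  apply: cderiv_eq.
    exact: cderivD (cderiv_cst (conjc b) t) (cderivM (cderiv_id t) (cderiv_cst (conjc a)
      t)).
  by rewrite mulr0 addr0 add0r mul1r.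
apply: cderiv_eq.
  apply: cderivM; first exact: cderivM (cderivX j dz) (cderivX k dJ).
  exact: cderiv_cexp (cderivN (cderivM dz dJ)).
rewrite /= /dmoment /moment; set z := b + _; set E := cexp _; rewrite !exprS.
ring.
Qed.

Lemma cintegrable_dmoment d (T : measurableType d) (m : {measure set T -> \bar R})
    (l : T -> C) j k a :
  (forall j k, cintegrable m (fun x => moment j k (l x))) ->
  cintegrable m (fun x => dmoment j k a (l x)).
Proof.
move=> h; rewrite /dmoment.
under eq_fun do rewrite -!mulNr.
by do 3 (apply: cintegrableD; last exact: cintegrableZ); exact: cintegrableZ.
Qed.

Lemma integral_dmoment_slice a b j k c :
  (forall t, halfgauss (Re (b + t%:C * a)) * halfgauss (Im (b + t%:C * a)) <= halfgauss
    t) ->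
  mu.-integrable setT (EFin \o (fun t => Re (c * dmoment j k a (b + t%:C * a)))) /\
  \int[mu]_(t in setT) Re (c * dmoment j k a (b + t%:C * a)) = 0.
Proof.
move=> hb.
have dl t := cderivD (cderiv_cst b t) (cderivM (cderiv_id t) (cderiv_cst a t)).
have cont_ReIm (f : R -> C) : (forall t, exists d, cderiv f t d) ->
    continuous (fun t => Re (f t)) /\ continuous (fun t => Im (f t)).
  by move=> df; split=> t; have [d /cderiv_continuous[]] := df t.
have ml : cmeasurable (fun t : measurableTypeR R => b + t%:C * a).
  have [c1 c2] := cont_ReIm _ (fun t => ex_intro _ _ (dl t)).
  by split; exact: continuous_measurable_fun.
have I : mu.-integrable setT (EFin \o (fun t => Re (c * dmoment j k a (b + t%:C * a)))).
  by apply: cintegrable_dmoment => j' k'; exact: moment_slice_cintegrable.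
split=> //.
(* The signs s = 1 and s = -1 give the two ends of the line. *)
have F0 (s : R) : s ^+ 2 = 1 ->
    Re (c * moment j k (b + (s * n%:R)%:C * a)) @[n --> \oo] --> (0 : R).
  move=> s1; apply/norm_cvg0P.
  apply: (@squeeze_cvgr _ _ _ _ (cst 0)
    (fun n => normc c * moment_bound (j + k) * halfgauss n%:R)).
  - apply: nearW => n; rewrite normr_ge0 /=; apply: le_trans (normc_Re _) _.
    rewrite Normc.normcM -mulrA ler_wpM2l ?normc_ge0//.
    apply: le_trans (normc_moment_le _ _ _) _; rewrite ler_wpM2l ?moment_bound_ge0//.
    by apply: le_trans (hb _) _; rewrite /halfgauss exprMn s1 mul1r.
  - exact: cvg_cst.
  - rewrite -[X in _ --> X](mulr0 (normc c * moment_bound (j + k))).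
    by apply: cvgM; [exact: cvg_cst|exact: cvg_halfgauss].
apply: (@Rintegral_derive_setT _ (fun t => Re (c * moment j k (b + t%:C * a)))) => //.
- have [] // := cont_ReIm (fun t => c * dmoment j k a (b + t%:C * a)).
  move=> t; have dM j k := cderiv_moment j k a b t.
  eexists; apply: cderivM (cderiv_cst c t) _.
  do 2 (apply: cderivD; last by apply: cderivN; apply: cderivM (cderiv_cst _ _) _;
    exact: dM).
  by apply: cderivD; apply: cderivM (cderiv_cst _ _) _; exact: dM.
- move=> t; have [] := cderivM (cderiv_cst c t) (cderiv_moment j k a b t).
  by rewrite mul0r add0r.
- by have := F0 1 (expr1n _ _); under eq_fun do rewrite mul1r.
- have := F0 (-1); rewrite sqrrN expr1n => /(_ erefl).
  by under eq_fun do rewrite mulN1r.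
Qed.

Lemma cint_dmoment1 j k : cint nu (fun p => dmoment j k 1 (point p)) 0.
Proof.
have h : cintegrable nu (fun p => dmoment j k 1 (point p)).
  by apply: cintegrable_dmoment => j' k'; exact: moment_cintegrable.
move=> c; split; first exact: h.
rewrite mulr0 /Rintegral -(integral21_prod_meas1 (h c)) integral0_eq// => y _.
rewrite /fubini_G /=.
have pE x : point (x, y) = (0 +i* y) + x%:C * 1.
  by apply: complex_ext; rewrite mulr1 /= ?add0r ?addr0.
have [|I +] := @integral_dmoment_slice 1 (0 +i* y) j k c.
  move=> t; rewrite mulr1 /= add0r addr0 ler_piMr ?halfgauss_ge0//.
  exact: halfgauss_le1.
rewrite /Rintegral => /eqP.
under eq_integral do rewrite -pE.
(* Since [fine] also sends infinite values to 0, finiteness of the slice integral is needed to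
   conclude that it vanishes. *)
rewrite fine_eq0; first by move/eqP.
apply: integrable_fin_num => //.
by move: I; apply: eq_integrable => // x _ /=; rewrite pE.
Qed.

Lemma cint_dmomenti j k : cint nu (fun p => dmoment j k 'i%C (point p)) 0.
Proof.
have h : cintegrable nu (fun p => dmoment j k 'i%C (point p)).
  by apply: cintegrable_dmoment => j' k'; exact: moment_cintegrable.
move=> c; split; first exact: h.
rewrite mulr0 /Rintegral -(integral12_prod_meas1 (h c)) integral0_eq// => x _.
rewrite /fubini_F /=.
have pE y : point (x, y) = x%:C + y%:C * 'i%C.
  by apply: complex_ext; rewrite (ReD, ImD) (ReM, ImM) /=; ring.
have [|I +] := @integral_dmoment_slice 'i%C x%:C j k c.
  move=> t; rewrite -pE /= ler_piMl ?halfgauss_ge0//.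
  exact: halfgauss_le1.
rewrite /Rintegral => /eqP.
under eq_integral do rewrite -pE.
rewrite fine_eq0; first by move/eqP.
apply: integrable_fin_num => //.
by move: I; apply: eq_integrable => // y _ /=; rewrite pE.
Qed.

Lemma cint_moment00 : cint nu (fun p => moment 0 0 (point p)) pi%:C.
Proof.
have mg := @measurable_gauss_fun R; have g0 := @gauss_fun_ge0 R.
have H := integral_plane_prod mg mg g0 g0 (@integralT_gauss R) (@integralT_gauss R).
have E p : moment 0 0 (point p) = (gauss_fun p.1 * gauss_fun p.2)%:C.
  by rewrite /moment !expr0 !mul1r mulcJ -rmorphN cexpR normc_sqr opprD expRD.
have I := moment_cintegrable 0 0.
move=> c; split; first exact: I.
under eq_Rintegral do rewrite E mulrC ReMr mulrC.
rewrite mulrC ReMr mulrC RintegralZl//.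
  by rewrite /Rintegral H /= -expr2 sqr_sqrtr// pi_ge0.
have := I 1; apply: eq_integrable => // p _; congr (_%:E).
by rewrite mul1r E.
Qed.

(** The derivatives in the directions 1 and i combine, with coefficient i or -i, into 2 d/dconj(z)
    or 2 d/dz. Their zero integrals say that the moment (j+1, k) is k times (j, k-1), and (j, k+1)
    is j times (j-1, k). Both indices thus descend together, to (0, 0) or to a vanishing factor. *)
Lemma cint_moment j k :
  cint nu (fun p => moment j k (point p)) ((j == k)%:R * (pi * j`!%:R)%:C).
Proof.
have two0 : (2 : C) != 0 by rewrite pnatr_eq0.
have conjci : conjc 'i%C = - 'i%C :> C by apply: complex_ext; rewrite /= ?oppr0.
have rec v w j' k' : cint nu (fun p => moment j'.+1 k' (point p)) v ->
    cint nu (fun p => moment j' k'.-1 (point p)) w -> v = k'%:R * w.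
  move=> hv hw.
  have h0 := cintD (cint_dmoment1 j' k') (cintZ 'i%C (cint_dmomenti j' k')).
  have h1 := cintD (cintZ (2 * k'%:R) hw) (cintZ (-2) hv).
  have h2 := cint_uniq h1 (eq_cint _ h0).
  have {h2} : 2 * k'%:R * w + -2 * v = 0 + 'i%C * 0.
    by apply: h2 => p; rewrite /dmoment conjci conjc1; ring: (sqr_i R).
  by rewrite mulr0 addr0 => /eqP; rewrite mulNr subr_eq0 -mulrA => /eqP /(mulfI two0).
have rec2 v w j' k' : cint nu (fun p => moment j' k'.+1 (point p)) v ->
    cint nu (fun p => moment j'.-1 k' (point p)) w -> v = j'%:R * w.
  move=> hv hw.
  have h0 := cintD (cint_dmoment1 j' k') (cintZ (- 'i%C) (cint_dmomenti j' k')).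
  have h1 := cintD (cintZ (2 * j'%:R) hw) (cintZ (-2) hv).
  have h2 := cint_uniq h1 (eq_cint _ h0).
  have {h2} : 2 * j'%:R * w + -2 * v = 0 + - 'i%C * 0.
    by apply: h2 => p; rewrite /dmoment conjci conjc1; ring: (sqr_i R).
  by rewrite mulr0 addr0 => /eqP; rewrite mulNr subr_eq0 -mulrA => /eqP /(mulfI two0).
have ex j' k' := cintegrable_cint (moment_cintegrable j' k').
elim: j k => [|j IH] [|k].
- by rewrite eqxx mul1r fact0 mulr1; exact: cint_moment00.
- have [v hv] := ex 0 k.+1; have [w hw] := ex 0 k.
  by rewrite mul0r; have := rec2 _ _ _ _ hv hw; rewrite mul0r => <-.
- have [v hv] := ex j.+1 0; have [w hw] := ex j 0.
  by rewrite mul0r; have := rec _ _ _ _ hv hw; rewrite mul0r => <-.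
- have [v hv] := ex j.+1 k.+1; have vE := rec _ _ _ _ hv (IH k).
  move: hv; rewrite vE eqSS; case: eqP => [<-|_]; last by rewrite !mul0r mulr0.
  by rewrite !mul1r factS natrM natc -rmorphM mulrCA.
Qed.

End gaussian_moments.

(** * Determinant of a bordered matrix *)

Lemma det_border_idomain (D : idomainType) n (A : 'M[D]_n) (b : 'cV_n) (c : 'rV_n) (d : D) :
  \det A != 0 ->
  \det (block_mx A b c d%:M) = d * \det A - (c *m \adj A *m b) 0 0.
Proof.
move=> A0; set M := block_mx _ _ _ _.
(* Block elimination without division: the product of M and B is block lower triangular, and the
   nonzero factor det A det (adj A) is cancelled afterwards. *)
pose B := block_mx (\adj A) (- (\adj A *m b)) 0 (\det A)%:M : 'M[D]_(n + 1).
have MB : M *m B = block_mx (\det A)%:M 0 (c *m \adj A) (d * \det A - (c *m \adj A *m b)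
  0 0)%:M.
  rewrite mulmx_block !mulmx0 !addr0 mul_mx_adj !mulmxN mulmxA mul_mx_adj.
  congr block_mx.
    by rewrite mul_scalar_mx mul_mx_scalar addNr.
  rewrite addrC mulmxA -scalar_mxM; apply/matrixP => i j.
  by rewrite !ord1 !mxE eqxx !mulr1n.
have := congr1 determinant MB; rewrite det_mulmx det_ublock det_lblock !det_scalar1
  det_scalar.
have <- : \det A * \det (\adj A) = \det A ^+ n by rewrite -det_mulmx mul_mx_adj det_scalar.
have adj0 : \det (\adj A) != 0.
  have : \det A * \det (\adj A) != 0 by rewrite -det_mulmx mul_mx_adj det_scalar expf_neq0.
  by rewrite mulf_eq0 negb_or => /andP[].
move=> h; apply: (mulIf (mulf_neq0 A0 adj0)); rewrite [RHS]mulrC -h.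
by rewrite [\det A * _]mulrC.
Qed.

(* For singular [A], the invertible case is applied to [A + X] over the
   polynomials and then evaluated at 0. *)
Lemma det_border (F : idomainType) n (A : 'M[F]_n) (b : 'cV_n) (c : 'rV_n) (d : F) :
  \det (block_mx A b c d%:M) = d * \det A - (c *m \adj A *m b) 0 0.
Proof.
pose A' := char_poly_mx (- A).
have A'0 : \det A' != 0 by rewrite -/(char_poly _) monic_neq0 ?char_poly_monic.
have := det_border_idomain (map_mx polyC b) (map_mx polyC c) d%:P A'0.
have evC m k (M : 'M[F]_(m, k)) : map_mx (horner_eval 0) (map_mx polyC M) = M.
  by apply/matrixP => i j; rewrite !mxE /horner_eval hornerC.
have evA : map_mx (horner_eval 0) A' = A.
  apply/matrixP => i j; rewrite !mxE /horner_eval hornerD hornerN hornerC opprK.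
  by rewrite hornerMn hornerX mul0rn add0r.
move/(congr1 (horner_eval 0)); rewrite rmorphB rmorphM /= -!det_map_mx.
rewrite map_block_mx map_scalar_mx !evC evA /=.
have -> : horner_eval 0 d%:P = d by rewrite /horner_eval hornerC.
move=> ->; congr (_ - _).
transitivity ((map_mx (horner_eval 0) (map_mx polyC c *m \adj A' *m map_mx polyC b)) 0 0).
  by rewrite [RHS]mxE.
by rewrite !map_mxM map_mx_adj !evC evA.
Qed.


(** * The kernel: symmetry, reproducing property and trace *)

Section ginibre_kernel.
Variable R : realType.
Local Notation C := R[i].
Local Notation plane := (measurableTypeR R * measurableTypeR R)%type.
Local Notation nu := (@plane_lebesgue R).
Implicit Types (z w x : C).

Definition ginibre_kernel N z w : C :=
  (pi^-1)%:C * (cexp (- (z * conjc z / 2)) * cexp (- (w * conjc w / 2))) *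
  \sum_(l < N) (z * conjc w) ^+ l / l`!%:R.

Definition kernel_mx N n (z : 'rV[C]_n) : 'M[C]_n :=
  \matrix_(i, j) ginibre_kernel N (z 0 i) (z 0 j).

Lemma conj_natV n : conjc (n%:R^-1 : C) = n%:R^-1.
Proof. by rewrite conjc_inv conjc_nat. Qed.

Lemma conj_ginibre_kernel N z w : conjc (ginibre_kernel N z w) = ginibre_kernel N w z.
Proof.
have cJ x : conjc (cexp (- (x * conjc x / 2))) = cexp (- (x * conjc x / 2)).
  have -> : x * conjc x / 2 = (normc x ^+ 2 / 2)%:C.
    by rewrite mulcJ [in RHS]rmorphM fmorphV rmorph_nat.
  by rewrite -rmorphN conj_cexp [conjc _%:C]conjc_real.
have JM x y : conjc (x * y) = conjc x * conjc y by rewrite rmorphM.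
rewrite /ginibre_kernel JM (JM _%:C) (JM (cexp _)) !cJ [conjc _%:C]conjc_real rmorph_sum.
rewrite [cexp (- (z * _ / 2)) * _]mulrC; congr (_ * _).
apply: eq_bigr => l _; rewrite [LHS]JM conj_natV rmorphXn; congr (_ ^+ _ / _).
by rewrite [LHS]JM conjcK mulrC.
Qed.

Lemma kernel_det_real N n (z : 'rV[C]_n) : Im (\det (kernel_mx N z)) = 0.
Proof.
have h : conjc (\det (kernel_mx N z)) = \det (kernel_mx N z).
  rewrite -[RHS]det_tr -(det_map_mx (conjc : {rmorphism C -> C})); congr determinant.
  by apply/matrixP => i j; rewrite !mxE; exact: conj_ginibre_kernel.
have := congr1 (@complex.Im R) h; rewrite ImJ; lra.
Qed.

Lemma pi_complex_neq0 : (pi : R)%:C != 0 :> C.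
Proof. by rewrite fmorph_eq0 gt_eqF// pi_gt0. Qed.

Lemma pi_invE : (pi^-1 : R)%:C = (pi%:C)^-1 :> C.
Proof. by rewrite fmorphV. Qed.

Lemma pi_factE k : (pi * k`!%:R : R)%:C = pi%:C * k`!%:R :> C.
Proof. by rewrite rmorphM rmorph_nat. Qed.

Lemma ginibre_kernel_reproducing N z w :
  cint nu (fun p => ginibre_kernel N z (point p) * ginibre_kernel N (point p) w)
    (ginibre_kernel N z w).
Proof.
(* The integration variable is conjugated in the first kernel, with exponent j, and plain in the
   second, with exponent k; hence [moment k j], and only the terms with j = k survive. *)
pose a j k : C := (pi^-1)%:C ^+ 2 * (cexp (- (z * conjc z / 2)) * cexp (- (w * conjc w /
  2))) *
  (z ^+ j * conjc w ^+ k / (j`!%:R * k`!%:R)).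
have H := cint_sum (index_enum 'I_N) (fun j : 'I_N => cint_sum (index_enum 'I_N)
  (fun k : 'I_N => cintZ (a j k) (@cint_moment R k j))).
rewrite (_ : ginibre_kernel N z w =
  \sum_(j < N) \sum_(k < N) a j k * ((k == j :> nat)%:R * (pi * k`!%:R)%:C)); last first.
  rewrite /ginibre_kernel mulr_sumr; apply: eq_bigr => j _.
  rewrite (bigD1 j)//= eqxx big1 ?addr0; last first.
    by move=> k /negbTE kj; rewrite (_ : (k == j :> nat) = false) ?mul0r ?mulr0.
  rewrite /a pi_factE pi_invE mul1r exprMn.
  move: (pi%:C) pi_complex_neq0 => P P0; field.
  by rewrite factc_neq0.
apply: eq_cint H => p /=; set x := point p.
rewrite /ginibre_kernel; set ez := cexp _; set ew := cexp (- (w * _ / 2)).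
transitivity ((pi^-1)%:C ^+ 2 * (ez * ew) * cexp (- (x * conjc x)) *
   ((\sum_(l < N) (z * conjc x) ^+ l / l`!%:R) * (\sum_(l < N) (x * conjc w) ^+ l /
     l`!%:R))); last first.
  have -> : - (x * conjc x) = - (x * conjc x / 2) + - (x * conjc x / 2) by field.
  by rewrite cexpD; ring.
rewrite mulr_suml mulr_sumr; apply: eq_bigr => j _.
rewrite mulr_sumr mulr_sumr; apply: eq_bigr => k _.
rewrite /moment /a -/ez -/ew !exprMn; move: (pi^-1)%:C => P; field.
by rewrite !factc_neq0.
Qed.

Lemma kernel_trace N : cint nu (fun p => ginibre_kernel N (point p) (point p)) N%:R.
Proof.
have H := cint_sum (index_enum 'I_N) (fun j : 'I_N =>
  cintZ ((pi^-1)%:C / j`!%:R) (@cint_moment R j j)).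
rewrite (_ : N%:R = \sum_(j < N) (pi^-1)%:C / j`!%:R * ((j == j :> nat)%:R * (pi *
  j`!%:R)%:C)); last first.
  rewrite (eq_bigr (fun=> 1)) ?sumr_const ?card_ord// => j _.
  rewrite eqxx mul1r pi_factE pi_invE.
  move: (pi%:C) pi_complex_neq0 => P P0; field.
  by rewrite P0 factc_neq0.
apply: eq_cint H => p; rewrite /ginibre_kernel -cexpD -mulrA mulr_sumr mulr_sumr.
apply: eq_bigr => j _; rewrite /moment exprMn.
rewrite (_ : - _ + _ = - (point p * conjc (point p))); last by field.
move: (pi^-1)%:C => P; ring.
Qed.

End ginibre_kernel.

(** * Correlation functions as determinants of the kernel *)

Section determinantal_structure.
Variable R : realType.
Local Notation C := R[i].
Local Notation plane := (measurableTypeR R * measurableTypeR R)%type.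
Local Notation nu := (@plane_lebesgue R).
Implicit Types (z w x : C).

Definition weight_const N : R := \prod_(l < N) (pi * l`!%:R).

Lemma weight_const_gt0 N : 0 < weight_const N.
Proof. by apply: prodr_gt0 => l _; rewrite mulr_gt0 ?pi_gt0// ltr0n fact_gt0. Qed.

Lemma kernel_mx_factor N n (z : 'rV[C]_n) : kernel_mx N z =
  diag_mx (\row_i cexp (- (z 0 i * conjc (z 0 i) / 2))) *m (Vandermonde N z)^T *m
  diag_mx (\row_l ((pi * l`!%:R)%:C)^-1) *m map_mx conjc (Vandermonde N z) *m
  diag_mx (\row_i cexp (- (z 0 i * conjc (z 0 i) / 2))).
Proof.
apply/matrixP => i j; rewrite mul_mx_diag !mxE.
rewrite (eq_bigr (fun l : 'I_N => cexp (- (z 0 i * conjc (z 0 i) / 2)) * z 0 i ^+ l *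
  ((pi * l`!%:R)%:C)^-1 * conjc (z 0 j) ^+ l)); last first.
  by move=> l _; rewrite mul_mx_diag mul_diag_mx !mxE rmorphXn.
rewrite /ginibre_kernel mulr_sumr mulr_suml; apply: eq_bigr => l _.
rewrite pi_factE pi_invE exprMn invfM; ring.
Qed.

Lemma ginibre_weightE N (g : 'rV[C]_N) :
  (ginibre_weight g)%:C = (weight_const N)%:C * \det (kernel_mx N g).
Proof.
have -> : (ginibre_weight g)%:C = \prod_(j < N) (expR (- normc (g 0 j) ^+ 2))%:C *
    (\det (Vandermonde N g) * conjc (\det (Vandermonde N g))).
  by rewrite mulcJ -rmorph_prod -rmorphM.
have -> : (weight_const N)%:C = \prod_(l < N) (pi * l`!%:R)%:C by rewrite -rmorph_prod.
rewrite kernel_mx_factor !det_mulmx !det_diag det_tr.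
rewrite (det_map_mx (conjc : {rmorphism C -> C})) /=.
rewrite [\prod_(i < N) (\row__ _^-1) _ _](eq_bigr (fun l : 'I_N => ((pi *
  l`!%:R)%:C)^-1)); last first.
  by move=> l _; rewrite mxE.
rewrite (eq_bigr (fun i => cexp (- (g 0 i * conjc (g 0 i) / 2)) *
    cexp (- (g 0 i * conjc (g 0 i) / 2)))); last first.
  by move=> i _; rewrite -cexpD mulcJ -cexpR rmorphN; congr cexp; field.
rewrite big_split /=.
rewrite [\prod_(i < N) (\row__ cexp _) _ _](eq_bigr (fun i : 'I_N => cexp (- (g 0 i *
  conjc (g 0 i) / 2)))); last first.
  by move=> l _; rewrite mxE.
set B := \prod_(i < N) (pi * _)%:C; set E := \prod_(i < N) _^-1.
have BD : B * E = 1.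
  rewrite -big_split big1// => l _; rewrite /= divff// pi_factE.
  by rewrite mulf_neq0 ?pi_complex_neq0 ?factc_neq0.
set D := \prod_(i < N) _; set V := \det _.
by rewrite -[LHS]mul1r -BD; ring.
Qed.

(** The adjugate does not involve x, so x occurs only through K(x, x) and products of two kernels,
    the integrands of the trace and of the reproducing identity. *)
Lemma det_kernel_mx_cons N n (z : 'rV[C]_n) x :
  \det (kernel_mx N (row_mx z (x%:M : 'rV_1))) =
  ginibre_kernel N x x * \det (kernel_mx N z) -
  \sum_(j < n) \sum_(i < n) \adj (kernel_mx N z) i j *
    (ginibre_kernel N (z 0 j) x * ginibre_kernel N x (z 0 i)).
Proof.
rewrite (_ : kernel_mx N _ = block_mx (kernel_mx N z) (\col_i ginibre_kernel N (z 0 i) x)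
   (\row_j ginibre_kernel N x (z 0 j)) (ginibre_kernel N x x)%:M); last first.
  apply/matrixP => i j; rewrite !mxE.
  by case: splitP => i' _; rewrite !mxE; case: splitP => j' _;
    rewrite !mxE ?ord1 ?eqxx ?mulr1n.
rewrite det_border mxE; congr (_ - _); apply: eq_bigr => j _.
rewrite mxE mulr_suml; apply: eq_bigr => i _; rewrite !mxE; ring.
Qed.

(** The trace contributes N det K. By reproduction the double sum becomes the trace of K adj(K),
    which is n det K. *)
Lemma cint_det_kernel_mx N n (z : 'rV[C]_n) :
  cint nu (fun p => \det (kernel_mx N (row_mx z ((point p)%:M : 'rV_1))))
    ((N%:R - n%:R) * \det (kernel_mx N z)).
Proof.
have := cintD (cintZ (\det (kernel_mx N z)) (@kernel_trace R N))
  (cintZ (-1) (cint_sum (index_enum 'I_n) (fun j => cint_sum (index_enum 'I_n) (fun i =>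
    cintZ (\adj (kernel_mx N z) i j) (ginibre_kernel_reproducing N (z 0 j) (z 0 i)))))).
set v := _ + _; have -> : v = (N%:R - n%:R) * \det (kernel_mx N z).
  rewrite /v mulN1r mulrBl [_ * N%:R]mulrC; congr (_ - _).
  rewrite (eq_bigr (fun=> \det (kernel_mx N z)));
    first by rewrite sumr_const card_ord mulr_natl.
  move=> j _; have := congr1 (fun M : 'M[C]_n => M j j) (mul_mx_adj (kernel_mx N z)).
  rewrite !mxE eqxx mulr1n => <-; apply: eq_bigr => i _.
  by rewrite [kernel_mx N z j i]mxE mulrC.
by apply: eq_cint => p; rewrite det_kernel_mx_cons mulN1r mulrC.
Qed.

Lemma ginibre_weight_ge0 N (g : 'rV[C]_N) : 0 <= ginibre_weight g.
Proof.
by rewrite mulr_ge0 ?exprn_ge0 ?normc_ge0// prodr_ge0// => i _; rewrite expR_ge0.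
Qed.

Lemma complex_row_cons m (p : plane) (t : m.-tuple plane) :
  complex_row (tuple_cons (p, t)) = row_mx ((point p)%:M : 'rV_1) (complex_row t).
Proof.
apply/rowP => i; rewrite mxE.
rewrite -(@splitK 1 m i); case: (fintype.split _) => i' /=.
  rewrite [RHS](row_mxEl ((point p)%:M : 'rV_1) (complex_row t)).
  by rewrite ord1 mxE eqxx mulr1n (tnth_nth p).
rewrite [RHS](row_mxEr ((point p)%:M : 'rV_1) (complex_row t)).
by rewrite mxE !(tnth_nth p).
Qed.

Lemma measurable_ginibre_weight d (T : measurableType d) N (f : T -> 'rV[C]_N) :
  (forall i, cmeasurable (fun t => f t 0 i)) ->
  measurable_fun setT (fun t => ginibre_weight (f t)).
Proof.
move=> mf; apply: measurable_funM.
  apply: measurable_prod => i _; apply: measurableT_comp => //.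
  by apply: measurableT_comp => //; exact: measurable_normc_sqr.
apply: measurable_normc_sqr; apply: cmeasurable_det => i j.
by under eq_fun do rewrite mxE; exact: cmeasurableX.
Qed.

Lemma cmeasurable_row_mx n m (z : 'rV[C]_n) (i : 'I_(n + m)) :
  cmeasurable (fun t : m.-tuple plane => row_mx z (complex_row t) 0 i).
Proof.
rewrite -(splitK i); case: (fintype.split _) => j /=.
  by under eq_fun do rewrite row_mxEl; exact: cmeasurable_cst.
under eq_fun do rewrite row_mxEr mxE.
by split => /=; apply: measurableT_comp => //; exact: measurable_tnth.
Qed.

Lemma castmx_rowE n n' (e : n = n') (M : 'rV[C]_n) i :
  castmx (erefl, e) M 0 i = M 0 (cast_ord (esym e) i).
Proof. by rewrite castmxE; congr (M _ _); apply: val_inj. Qed.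

Lemma det_kernel_mx_cast N n n' (e : n = n') (z : 'rV[C]_n) :
  \det (kernel_mx N (castmx (erefl, e) z)) = \det (kernel_mx N z).
Proof. by case: _ / e; rewrite castmx_id. Qed.

Lemma ginibre_weight_cast n n' (e : n = n') (z : 'rV[C]_n) :
  ginibre_weight (castmx (erefl, e) z) = ginibre_weight z.
Proof. by case: _ / e; rewrite castmx_id. Qed.

Lemma ginibre_weight_Re N (g : 'rV[C]_N) :
  ginibre_weight g = weight_const N * Re (\det (kernel_mx N g)).
Proof. by rewrite -ReMr -ginibre_weightE. Qed.

(* The variables are integrated out one at a time, each contributing a factor
   [N - n = m], [m] being the number of variables left. *)
Lemma integral_ginibre_weight m N n (e : (n + m)%N = N) (z : 'rV[C]_n) :
  (\int[power_measure nu m]_t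
     (ginibre_weight (castmx (erefl, e) (row_mx z (complex_row t))))%:E =
   (m`!%:R * weight_const N * Re (\det (kernel_mx N z)))%:E)%E.
Proof.
have mw n' m' (e' : (n' + m')%N = N) (z' : 'rV[C]_n') : measurable_fun setT
    (fun t : m'.-tuple plane => (ginibre_weight (castmx (erefl, e') (row_mx z'
      (complex_row t))))%:E).
  apply/measurable_EFinP; apply: measurable_ginibre_weight => i.
  by under eq_fun do rewrite castmx_rowE; exact: cmeasurable_row_mx.
elim: m n e z => [|m IH] n e z.
  rewrite /= integral_dirac//; last exact: mw.
  rewrite diracT mul1e fact0 mul1r ginibre_weight_Re det_kernel_mx_cast.
  congr ((_ * Re _)%:E); rewrite -(det_kernel_mx_cast N (esym (addn0 n)) z).
  congr (\det (kernel_mx N _)); apply/rowP => i; rewrite castmx_rowE mxE.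
  case: fintype.splitP => j ij; last by case: (j) => [].
  by congr (z 0 _); apply: val_inj; rewrite /= ij.
have e1 : ((n + 1) + m)%N = N by rewrite -addnA add1n.
rewrite ge0_integral_power_measureS; [|exact: mw|by move=> t;
  rewrite lee_fin ginibre_weight_ge0].
under eq_integral => p _.
  under eq_integral => t _.
    rewrite ginibre_weight_cast complex_row_cons.
    rewrite (_ : row_mx z _ = castmx (erefl, esym (addnA n 1 m)) (row_mx (row_mx z (point
      p)%:M) (complex_row t))); last first.
      exact: row_mxA.
    rewrite ginibre_weight_cast -(ginibre_weight_cast e1).
    over.
  rewrite IH.
  over.
(* The test scalar of [cint] carries the constant produced by the induction hypothesis. *)
have [I1 I2] := cint_det_kernel_mx N z ((m`!%:R * weight_const N)%:C).
have Nn : N%:R - n%:R = m.+1%:R :> C by rewrite -e natrD addrAC subrr add0r.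
move: I2; rewrite Nn mulrA natc -rmorphM ReMr.
have -> : m`!%:R * weight_const N * m.+1%:R = m.+1`!%:R * weight_const N :> R.
  by rewrite factS natrM; ring.
move=> <-; rewrite /Rintegral fineK; last exact: integrable_fin_num.
by apply: eq_integral => p _; rewrite ReMr.
Qed.

Lemma ginibre_partitionE N : ginibre_partition R N = weight_const N.
Proof.
rewrite /ginibre_partition /Rintegral.
have := @integral_ginibre_weight N N 0 erefl 0.
rewrite (eq_integral (fun t => (ginibre_weight (complex_row t))%:E)); last first.
  by move=> t _; rewrite castmx_id row_thin_mx.
move=> ->; rewrite det_mx00 /= mulr1 mulrA mulVf ?mul1r//.
Qed.

Theorem ginibre_correlation_det N n (z : 'rV[C]_n) : (n <= N)%N ->
  (ginibre_correlation N z)%:C = \det (kernel_mx N z).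
Proof.
move=> nN; apply: complex_ext; last by rewrite kernel_det_real.
rewrite /ginibre_correlation ginibre_partitionE /Rintegral /=.
have := @integral_ginibre_weight (N - n) N n (subnKC nN) z.
rewrite (eq_integral (fun t => (ginibre_weight (row_mx z (complex_row t)))%:E)); last first.
  by move=> t _; rewrite ginibre_weight_cast.
move=> -> /=; field.
by rewrite pnatr_eq0 -lt0n fact_gt0 /= gt_eqF ?weight_const_gt0.
Qed.

End determinantal_structure.

(** * Translation by u sqrt N and the two scaling limits *)

Section scaling_limits.
Variable R : realType.
Local Notation C := R[i].
Implicit Types (z w u s t : C).

Lemma ccvg_shiftS (f : nat -> C) l : ccvg (fun n => f n.+1) l -> ccvg f l.
Proof.
by move=> [h1 h2]; split; [rewrite -(cvg_shiftS (fun n => Re (f n)))|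
  rewrite -(cvg_shiftS (fun n => Im (f n)))].
Qed.

Lemma near_eq_ccvg (f g : nat -> C) l : (\forall n \near \oo, f n = g n) ->
  ccvg f l -> ccvg g l.
Proof.
move=> fg [h1 h2]; split.
  by apply: cvg_trans h1; apply: near_eq_cvg; apply: filterS fg => n ->.
by apply: cvg_trans h2; apply: near_eq_cvg; apply: filterS fg => n ->.
Qed.

Lemma det_conjugate_diag n (p : 'I_n -> C) (A : 'M[C]_n) : (forall i, p i != 0) ->
  \det (\matrix_(i, j) (p i * A i j / p j)) = \det A.
Proof.
move=> p0.
rewrite (_ : \matrix_(i, j) _ = diag_mx (\row_i p i) *m A *m diag_mx (\row_i (p i)^-1));
  last first.
  by apply/matrixP => i j; rewrite mul_mx_diag mul_diag_mx !mxE.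
rewrite !det_mulmx !det_diag mulrAC -big_split big1 ?mul1r// => i _.
by rewrite /= !mxE divff.
Qed.

Definition gauss_kernel s t : C :=
  cexp (- (`|s| ^+ 2 / 2) - `|t| ^+ 2 / 2 + s * conjc t).

Lemma ginibre_kernelE N z w :
  ginibre_kernel N z w = (pi^-1)%:C * gauss_kernel z w * truncexp N (z * conjc w).
Proof.
rewrite /ginibre_kernel /truncexp /gauss_kernel !sqr_normc -[LHS]mulrA -[RHS]mulrA.
by rewrite [X in _ = _ * X]mulrA -!cexpD addrK.
Qed.

(** Half of the cross term left when the exponent of [gauss_kernel] is expanded at points shifted by
    u r. It is unimodular, the exponent being imaginary, and it cancels in determinants. *)
Definition phase (r : R) u s : C := cexp (r%:C * (conjc u * s - u * conjc s) / 2).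

Lemma gauss_kernel_shift (r : R) u s t :
  gauss_kernel (u * r%:C + s) (u * r%:C + t) =
  phase r u s * gauss_kernel s t / phase r u t.
Proof.
rewrite /gauss_kernel /phase -cexpN -!cexpD !sqr_normc; congr cexp.
have cE x : conjc (u * r%:C + x) = conjc u * r%:C + conjc x.
  by rewrite rmorphD rmorphM; congr (_ * _ + _); exact: conjc_real.
by rewrite !cE; field.
Qed.

Lemma det_kernel_mx_shift N n (r : R) u (s : 'rV[C]_n) :
  \det (kernel_mx N (\row_k (u * r%:C + s 0 k))) =
  \det (\matrix_(k, k') ((pi^-1)%:C * gauss_kernel (s 0 k) (s 0 k') *
    truncexp N ((u * r%:C + s 0 k) * conjc (u * r%:C + s 0 k')))).
Proof.
rewrite -[RHS](@det_conjugate_diag _ (fun k => phase r u (s 0 k))); last first.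
  by move=> i; exact: cexp_neq0.
congr (\det _); apply/matrixP => i j; rewrite !mxE ginibre_kernelE gauss_kernel_shift.
by move: (pi^-1)%:C (truncexp _ _) => P T; ring.
Qed.

Lemma truncexp_bulk_pair u s t : normc u < 1 ->
  let z n := u * (Num.sqrt n%:R)%:C + s in
  let w n := u * (Num.sqrt n%:R)%:C + t in
  ccvg (fun n => truncexp n.+1 (z n.+1 * conjc (w n.+1))) 1.
Proof.
move=> u1 z w; have u0 := normc_ge0 u.
(* Any r strictly between |u| and 1 works: both points are eventually of modulus at most r sqrt N,
   so their product is at most r^2 N. *)
pose r := (1 + normc u) / 2.
have r01 : 0 < r /\ r < 1 by rewrite /r; split; lra.
have [r0 r1] := r01.
have bnd x : \forall n \near \oo, normc (u * (Num.sqrt n.+1%:R)%:C + x) <= r * Num.sqrt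
  n.+1%:R.
  have h0 : 0 < r - normc u by rewrite /r; lra.
  near=> n.
  apply: le_trans (le_normcD _ _) _; rewrite Normc.normcM normc_real ger0_norm ?sqrtr_ge0//.
  rewrite -lerBrDl -mulrBl -ler_pdivrMl// .
  have hn : (normc x / (r - normc u)) ^+ 2 <= n%:R by near: n; exact: nbhs_infty_ger.
  rewrite mulrC -(@ler_pXn2r _ 2)// ?nnegrE ?sqrtr_ge0 ?divr_ge0 ?normc_ge0 ?(ltW h0)//.
  by rewrite sqr_sqrtr//; apply: le_trans hn _; rewrite ler_nat.
apply: (@ccvg_truncexp_bulk R _ (r ^+ 2) (normc (s - t) ^+ 2 / 2)).
- by rewrite exprn_gt0//= exprn_ilt1// ltW.
- by rewrite divr_ge0 ?exprn_ge0 ?normc_ge0.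
(* The constant c is |s - t|^2 / 2 because 2 (|z| |w| - Re (z conj(w))) = |z - w|^2 - (|z| - |w|)^2
   and z - w = s - t for all N. *)
- move=> n; rewrite Normc.normcM normcJ_eq.
  have -> : s - t = z n.+1 - w n.+1 by rewrite /z /w; ring.
  have := sqr_ge0 (normc (z n.+1) - normc (w n.+1)).
  have E (x y : C) : normc (x - y) ^+ 2 = normc x ^+ 2 + normc y ^+ 2 - 2 * Re (x * conjc
    y).
    by rewrite !normc_sqr ReD ImD ReN ImN ReM ReJ ImJ; ring.
  rewrite E sqrrB; lra.
- near=> n; rewrite Normc.normcM normcJ_eq.
  rewrite -[n.+1%:R]sqr_sqrtr// -exprMn expr2.
  by apply: ler_pM; rewrite ?normc_ge0//; near: n; exact: bnd.
Unshelve. all: by end_near. Qed.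

Lemma truncexp_edge_pair u s t : normc u = 1 ->
  let z n := u * (Num.sqrt n%:R)%:C + s in
  let w n := u * (Num.sqrt n%:R)%:C + t in
  ccvg (fun n => truncexp n.+2 (z n.+2 * conjc (w n.+2)))
    (2^-1 * cerfc ((s * conjc u + conjc t * u) / (Num.sqrt 2)%:C)).
Proof.
move=> u1 z w.
pose b := s * conjc u + conjc t * u.
(* With N = n + 2 and M = n + 1, z conj(w) = N + b sqrt N + s conj(t). Solving for the form M + M
   [gscale M] a, where 1 / (M [gscale M]) = [gscale M] / 2, gives this sequence; the summand 1 is N
   - M. *)
pose a n := (1 + s * conjc t) * (gscale n.+1 / 2)%:C +
  b * (Num.sqrt n.+2%:R * gscale n.+1 / 2)%:C.
have cva : ccvg a (b / (Num.sqrt 2)%:C).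
  have -> : b / (Num.sqrt 2)%:C = (1 + s * conjc t) * (0 / 2 : R)%:C + b * (Num.sqrt 2 /
    2)%:C.
    rewrite mul0r mulr0 add0r -fmorphV; congr (_ * _%:C).
    have s2 : Num.sqrt 2 != 0 :> R by rewrite gt_eqF// sqrtr_gt0.
    by apply: (mulIf s2); rewrite mulVf// mulrAC -expr2 sqr_sqrtr// divff.
  apply: ccvgD; apply: ccvgM; [exact: ccvg_cst| |exact: ccvg_cst|]; apply: ccvg_real;
    apply: cvgM; [exact: cvg_gscale|exact: cvg_cst| |exact: cvg_cst].
  rewrite (_ : (fun n => _) = (fun n => Num.sqrt (2 + 2 * harmonic n))); last first.
    apply/funext => n; rewrite /gscale -sqrtrM//; congr Num.sqrt; rewrite /harmonic /=;
      field.
    by rewrite nat1r pnatr_eq0.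
  apply: continuous_cvg; first exact: sqrt_continuous.
  rewrite -[X in _ --> X]addr0; apply: cvgD; first exact: cvg_cst.
  rewrite -[X in _ --> X](mulr0 2); apply: cvgM; first exact: cvg_cst.
  exact: cvg_harmonic.
apply: eq_ccvg (ccvg_truncexp_edge cva) => n; congr (truncexp _ _).
have M2 := @gscale_sqr R n.+1 (ltn0Sn n).
have M2c : (n.+1%:R * gscale n.+1)%:C * (gscale n.+1)%:C = 2 :> C.
  by rewrite -rmorphM -mulrA -expr2 M2 rmorph_nat.
have uu : u * conjc u = 1 by rewrite mulcJ u1 expr1n.
have rr : (Num.sqrt n.+2%:R)%:C ^+ 2 = n.+2%:R :> C.
  by rewrite -rmorphXn /= sqr_sqrtr// rmorph_nat.
rewrite /a /z /w /b.
have cE x : conjc (u * (Num.sqrt n.+2%:R)%:C + x) = conjc u * (Num.sqrt n.+2%:R)%:C +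
  conjc x.
  by rewrite rmorphD rmorphM; congr (_ * _ + _); exact: conjc_real.
rewrite cE.
have -> : (gscale n.+1 / 2 : R)%:C = (gscale n.+1)%:C / 2.
  by rewrite rmorphM fmorphV rmorph_nat.
have -> : (Num.sqrt n.+2%:R * gscale n.+1 / 2 : R)%:C =
    (Num.sqrt n.+2%:R)%:C * ((gscale n.+1)%:C / 2).
  by rewrite !rmorphM fmorphV rmorph_nat mulrA.
move: M2c rr; move: (_ * gscale _)%:C (gscale _)%:C (Num.sqrt _)%:C => g h r gh rr.
have gh2 : g * (h / 2) = 1 by rewrite mulrA gh divff// pnatr_eq0.
have -> : (u * r + s) * (conjc u * r + conjc t) =
  (u * conjc u) * r ^+ 2 + r * (s * conjc u + conjc t * u) + s * conjc t by ring.
rewrite uu rr -[n.+2%:R]natr1.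
have -> : g * ((1 + s * conjc t) * (h / 2) + (s * conjc u + conjc t * u) * (r * (h / 2))) =
  (g * (h / 2)) * ((1 + s * conjc t) + r * (s * conjc u + conjc t * u)) by ring.
by rewrite gh2; ring.
Qed.

End scaling_limits.

(* The source prints 1 / (2 pi) as the bulk constant; with the stated
   normalisation of R_n it is 1 / pi. For instance at u = 0, s = 0, n = 1,
   R_1(0) = 1 / pi for every N >= 1. The edge constant is 1 / (2 pi), as printed. *)
Theorem theoremC1 (R : realType) (n : nat) (u : R[i]) (s : 'rV[R[i]]_n)
    (hu : `|u| <= 1) :
  let z (N : nat) : 'rV[R[i]]_n :=
    \row_(k < n) (u * (Num.sqrt N%:R)%:C + s 0 k) in
  let E (k k' : 'I_n) : R[i] :=
    cexp (- (`|s 0 k| ^+ 2 / 2) - `|s 0 k'| ^+ 2 / 2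
          + s 0 k * conjc (s 0 k')) in
  (`|u| < 1 ->
    (fun N => (ginibre_correlation N (z N))%:C : R[i]^o) @ \oo -->
    (\det (\matrix_(k < n, k' < n) ((pi^-1)%:C * E k k')) : R[i]^o))
  /\
  (`|u| = 1 ->
    (fun N => (ginibre_correlation N (z N))%:C : R[i]^o) @ \oo -->
    (\det (\matrix_(k < n, k' < n)
       (((2 * pi)^-1)%:C * E k k' *
        cerfc ((s 0 k * conjc u + conjc (s 0 k') * u) / (Num.sqrt 2)%:C)))
     : R[i]^o)).
Proof.
move=> z E.
have corr_det N : (n <= N)%N -> (ginibre_correlation N (z N))%:C =
    \det (\matrix_(k, k') ((pi^-1)%:C * E k k' *
      truncexp N ((u * (Num.sqrt N%:R)%:C + s 0 k) *
        conjc (u * (Num.sqrt N%:R)%:C + s 0 k')))).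
  by move=> nN; rewrite ginibre_correlation_det// det_kernel_mx_shift.
have near_det (L : 'M[R[i]]_n) :
    (forall k k', ccvg (fun N => (pi^-1)%:C * E k k' *
      truncexp N ((u * (Num.sqrt N%:R)%:C + s 0 k) *
        conjc (u * (Num.sqrt N%:R)%:C + s 0 k'))) (L k k')) ->
    (fun N => (ginibre_correlation N (z N))%:C : R[i]^o) @ \oo --> (\det L : R[i]^o).
  move=> hL; apply: ccvg_cvg.
  apply: (@near_eq_ccvg _ (fun N => \det (\matrix_(k, k') ((pi^-1)%:C * E k k' *
      truncexp N ((u * (Num.sqrt N%:R)%:C + s 0 k) *
        conjc (u * (Num.sqrt N%:R)%:C + s 0 k')))))).
    (* The determinantal formula holds from N = n on, which suffices for the limit. *)
    by exists n => // N /= nN; rewrite -corr_det.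
  by apply: ccvg_det => k k'; apply: eq_ccvg (hL k k') => N; rewrite mxE.
split=> u1; apply: near_det => k k'; rewrite mxE.
- apply: ccvg_shiftS; rewrite -[X in ccvg _ X]mulr1.
  apply: ccvgM; first exact: ccvg_cst.
  by apply: truncexp_bulk_pair; rewrite -ltcR -normr_normc.
(* Two shifts, since the edge limit is stated for N = n + 2 so that M = N - 1 is positive. *)
- do 2 apply: ccvg_shiftS.
  have -> : ((2 * pi)^-1 : R)%:C = (pi^-1)%:C * 2^-1.
    by rewrite invfM rmorphM fmorphV rmorph_nat mulrC.
  rewrite [_ / 2 * E k k']mulrAC -[X in ccvg _ X]mulrA; apply: ccvgM; first exact: ccvg_cst.
  apply: truncexp_edge_pair.
  by apply: (@complexI R); rewrite -normr_normc.
Qed.
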